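(* Let $M$ be a lightlike hypersurface of an indefinite statistical manifold $(\overline{M},\overline{g},\overline{\nabla},\overline{\nabla}^{*})$, with screen distribution $S(TM)$, radical distribution $\mathrm{Rad}(TM)$, and induced connections $\nabla$ and $\nabla^{*}$. Assume that $\mathrm{Rad}(TM)$ and $S(TM)$ are parallel with respect to both $\nabla$ and $\nabla^{*}$. Then the following assertions are equivalent: (1) $\nabla$ is a metric connection; (2) $\nabla^{*}$ is a metric connection; (3) $K(X,W)=0$ for all $X\in\Gamma(TM)$ and $W\in\Gamma(S(TM))$; (4) $\nabla_X^{S}W=\nabla_X^{*S}W$ for all $X\in\Gamma(TM)$ and $W\in\Gamma(S(TM))$.
   Context: $\Gamma(E)$ denotes smooth sections of $E$. An indefinite statistical manifold $(\overline{M},\overline{g},\overline{\nabla},\overline{\nabla}^{*})$ is a semi-Riemannian manifold $(\overline M,\overline g)$ with a torsion-free affine connection $\overline\nabla$ satisfying the Codazzi condition $(\overline{\nabla}_{X}\overline{g})(Y,Z)=(\overline{\nabla}_{Y}\overline{g})(X,Z)$, together with the dual connection $\overline\nabla^{*}$ determined by $X\overline{g}(Y,Z)=\overline{g}(\overline{\nabla}_{X}Y,Z)+\overline{g}(Y,\overline{\nabla}^{*}_{X}Z)$ (which is then also torsion-free). $M$ is a lightlike hypersurface: $M$ has codimension one and the induced metric $g$ is degenerate, so $\mathrm{Rad}(TM)=TM\cap TM^{\perp}=TM^{\perp}$ is a rank-one bundle. A screen distribution $S(TM)$ is a non-degenerate distribution complementary to $\mathrm{Rad}(TM)$ in $TM$;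 one is fixed. Fix a nowhere-zero section $\xi$ of $\mathrm{Rad}(TM)$ (in general it exists only locally, and all objects depending on it are understood on its domain). $N$ is the unique vector field along $M$ with $\overline{g}(N,N)=0$, $\overline{g}(N,\xi)=1$, $\overline{g}(N,W)=0$ for all $W\in\Gamma(S(TM))$; then $T\overline M|_M=TM\oplus\mathrm{span}\{N\}$. For $X,Y\in\Gamma(TM)$ the Gauss formulas $\overline{\nabla}_{X}Y=\nabla_{X}Y+B(X,Y)N$ and $\overline{\nabla}^{*}_{X}Y=\nabla^{*}_{X}Y+B^{*}(X,Y)N$, with $\nabla_XY,\nabla^*_XY\in\Gamma(TM)$, define the induced torsion-free connections $\nabla,\nabla^{*}$. For $X\in\Gamma(TM)$, $W\in\Gamma(S(TM))$ the decompositions $\nabla_{X}W=\nabla^{S}_{X}W+C(X,W)\xi$ and $\nabla^{*}_{X}W=\nabla^{*S}_{X}W+C^{*}(X,W)\xi$, with $\nabla^{S}_{X}W,\nabla^{*S}_XW\in\Gamma(S(TM))$, define the induced connections $\nabla^{S},\nabla^{*S}$ on $S(TM)$. The difference tensor is $K(X,Y)=\frac12(\nabla_XY-\nabla^{*}_XY)$. A connection $D$ on $M$ is called a metric connection if $Dg=0$. A distribution $\mathcal D$ on $M$ is parallel with respect to $D$ if $D_XY\in\Gamma(\mathcal D)$ for all $X\in\Gamma(TM)$, $Y\in\Gamma(\mathcal D)$. *)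

(* Defs.v *)
From HB Require Import structures.
From mathcomp Require Import all_boot all_order all_algebra.
From mathcomp Require Import all_classical all_reals all_analysis.

Set Implicit Arguments.
Unset Strict Implicit.
Unset Printing Implicit Defensive.

Import Order.TTheory GRing.Theory Num.Theory.
Import numFieldNormedType.Exports.

Local Open Scope classical_set_scope.
Local Open Scope ring_scope.

(* C^k and C^oo maps between normed spaces, on a set A that is open in all uses. *)
Fixpoint Ck {R : realType} {V W : normedModType R} (k : nat) (A : set V)
    (f : V -> W) : Prop :=
  if k is k'.+1 then
    (forall x, A x -> differentiable f x) /\
    (forall v : V, Ck k' A (fun x => 'D_v f x))
  else forall x, A x -> {for x, continuous f}.

Definition Cinfty {R : realType} {V W : normedModType R} (A : set V)
  (f : V -> W) : Prop := forall k, Ck k A f.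

(* The smooth structure is given by an atlas, not necessarily maximal.
   [chart i] and [chart_inv i] are total functions, meaningful only on
   [chart_dom i] and on its image. [idx p] selects a chart around p. *)
Record smoothManifold (R : realType) (n : nat) := SmoothManifold {
  carrier :> topologicalType;
  manifold_hausdorff : hausdorff_space carrier;
  manifold_second_countable : @second_countable carrier;
  chart_index : Type;
  chart_dom : chart_index -> set carrier;
  chart : chart_index -> carrier -> 'rV[R]_n;
  chart_inv : chart_index -> 'rV[R]_n -> carrier;
  idx : carrier -> chart_index;
  chart_dom_open : forall i, open (chart_dom i);
  chart_image_open : forall i, open (chart i @` chart_dom i);
  chartK : forall i p, chart_dom i p -> chart_inv i (chart i p) = p;
  chart_continuous : forall i p, chart_dom i p ->
    {for p, continuous (chart i)};
  chart_inv_continuous : forall i p, chart_dom i p ->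
    {for chart i p, continuous (chart_inv i)};
  chart_transition : forall i j,
    Cinfty (chart i @` (chart_dom i `&` chart_dom j)) (chart j \o chart_inv i);
  idx_dom : forall p, chart_dom (idx p) p
}.

Section Manifolds.
Variable R : realType.

Definition chart_at n (M : smoothManifold R n) (p : M) : M -> 'rV[R]_n :=
  chart (idx p).
Definition chart_inv_at n (M : smoothManifold R n) (p : M) : 'rV[R]_n -> M :=
  chart_inv (idx p).

Definition smooth_fun_on n (M : smoothManifold R n) (W : normedModType R)
    (U : set M) (f : M -> W) : Prop :=
  forall i : chart_index M,
    Cinfty (chart i @` (chart_dom i `&` U)) (f \o chart_inv i).

Definition smooth_fun n (M : smoothManifold R n) (f : M -> R) : Prop :=
  smooth_fun_on setT (f : M -> R^o).

Definition smooth_map m n (M : smoothManifold R m) (N : smoothManifold R n)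
    (F : M -> N) : Prop :=
  continuous F /\
  forall j : chart_index N, smooth_fun_on (F @^-1` chart_dom j) (chart j \o F).

(* Tangent vectors. T_p M is identified with 'rV_n by the coordinates with
   respect to the chart [chart_at p]. Hence a section of F^*TN, for F : M -> N,
   is a function V : M -> 'rV_n, where V p is the coordinate vector of an
   element of T_{F p} N with respect to [chart_at (F p)]. Vector fields on M
   are sections along the identity. *)

(* coordinates of v : T_p M with respect to the chart i *)
Definition tcoord n (M : smoothManifold R n) (i : chart_index M) (p : M)
    (v : 'rV[R]_n) : 'rV[R]_n :=
  'd (chart i \o chart_inv_at p) (chart_at p p) v.

(* v f, for v : T_p M *)
Definition dirD n (M : smoothManifold R n) (p : M) (v : 'rV[R]_n)
    (f : M -> R) : R :=
  'd ((f : M -> R^o) \o chart_inv_at p) (chart_at p p) v.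

(* dF_p : T_p M -> T_{F p} N *)
Definition tmap m n (M : smoothManifold R m) (N : smoothManifold R n)
    (F : M -> N) (p : M) (v : 'rV[R]_m) : 'rV[R]_n :=
  'd (chart_at (F p) \o F \o chart_inv_at p) (chart_at p p) v.

Definition immersion m n (M : smoothManifold R m) (N : smoothManifold R n)
    (F : M -> N) : Prop :=
  smooth_map F /\ forall p, injective (tmap F p).

Definition smooth_section_on m n (M : smoothManifold R m)
    (N : smoothManifold R n) (F : M -> N) (U : set M) (V : M -> 'rV[R]_n)
    : Prop :=
  forall j : chart_index N,
    smooth_fun_on (U `&` F @^-1` chart_dom j) (fun p => tcoord j (F p) (V p)).

Definition smooth_section m n (M : smoothManifold R m)
    (N : smoothManifold R n) (F : M -> N) (V : M -> 'rV[R]_n) : Prop :=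
  smooth_section_on F setT V.

(* X is in Gamma(TM) *)
Definition vfield n (M : smoothManifold R n) (X : M -> 'rV[R]_n) : Prop :=
  smooth_section (fun p : M => p) X.

(* A distribution of rank r: a family of subspaces of the tangent spaces that
   has smooth local frames. *)
Definition distribution r n (M : smoothManifold R n)
    (D : M -> set 'rV[R]_n) : Prop :=
  forall p : M, exists (U : set M) (E : 'I_r -> M -> 'rV[R]_n),
    [/\ open U, U p,
        forall k, smooth_section_on (fun q : M => q) U (E k) &
        forall q, U q -> row_free (\matrix_(k < r) E k q) /\
          forall v, D q v <-> (v <= \matrix_(k < r) E k q)%MS].

(* Y is in Gamma(D) *)
Definition section_of n (M : smoothManifold R n) (D : M -> set 'rV[R]_n)
    (Y : M -> 'rV[R]_n) : Prop :=
  vfield Y /\ forall p, D p (Y p).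

(* Values on non-smooth arguments are irrelevant junk, also below. *)
Record connection_along m n (M : smoothManifold R m) (N : smoothManifold R n)
    (F : M -> N)
    (D : (M -> 'rV[R]_m) -> (M -> 'rV[R]_n) -> M -> 'rV[R]_n) : Prop := {
  conn_smooth : forall X V, vfield X -> smooth_section F V ->
    smooth_section F (D X V);
  conn_linear : forall (h : M -> R) X X' V, smooth_fun h -> vfield X ->
    vfield X' -> smooth_section F V -> forall p,
    D (fun q => h q *: X q + X' q) V p = h p *: D X V p + D X' V p;
  conn_additive : forall X V V', vfield X -> smooth_section F V ->
    smooth_section F V' -> forall p,
    D X (fun q => V q + V' q) p = D X V p + D X V' p;
  conn_leibniz : forall (h : M -> R) X V, smooth_fun h -> vfield X ->
    smooth_section F V -> forall p,
    D X (fun q => h q *: V q) p = dirD p (X p) h *: V p + h p *: D X V p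
}.

Definition affine_connection n (M : smoothManifold R n)
    (D : (M -> 'rV[R]_n) -> (M -> 'rV[R]_n) -> M -> 'rV[R]_n) : Prop :=
  connection_along (fun p : M => p) D.

(* D_X Y - D_Y X = [X, Y], where [X, Y] f = X (Y f) - Y (X f) *)
Definition torsion_free n (M : smoothManifold R n)
    (D : (M -> 'rV[R]_n) -> (M -> 'rV[R]_n) -> M -> 'rV[R]_n) : Prop :=
  forall X Y (f : M -> R), vfield X -> vfield Y -> smooth_fun f -> forall p,
    dirD p (D X Y p - D Y X p) f =
    dirD p (X p) (fun q => dirD q (Y q) f) -
    dirD p (Y p) (fun q => dirD q (X q) f).

(* The connection D on F^*TN induced by the connection nabla of N: the
   one with D_X (Z o F) = nabla_{dF X} Z. The right-hand side at F p depends
   only on the vector dF_p (X p), which is extended to a field X'. *)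
Definition pullback_connection m n (M : smoothManifold R m)
    (N : smoothManifold R n) (F : M -> N)
    (nabla : (N -> 'rV[R]_n) -> (N -> 'rV[R]_n) -> N -> 'rV[R]_n)
    (D : (M -> 'rV[R]_m) -> (M -> 'rV[R]_n) -> M -> 'rV[R]_n) : Prop :=
  connection_along F D /\
  forall X X' Z p, vfield X -> vfield X' -> vfield Z ->
    X' (F p) = tmap F p (X p) -> D X (Z \o F) p = nabla X' Z (F p).

(* (D_X g)(Y, Z) at p *)
Definition cov_metric n (M : smoothManifold R n)
    (g : M -> 'rV[R]_n -> 'rV[R]_n -> R)
    (D : (M -> 'rV[R]_n) -> (M -> 'rV[R]_n) -> M -> 'rV[R]_n)
    (X Y Z : M -> 'rV[R]_n) (p : M) : R :=
  dirD p (X p) (fun q => g q (Y q) (Z q))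
  - g p (D X Y p) (Z p) - g p (Y p) (D X Z p).

Definition metric_connection n (M : smoothManifold R n)
    (g : M -> 'rV[R]_n -> 'rV[R]_n -> R)
    (D : (M -> 'rV[R]_n) -> (M -> 'rV[R]_n) -> M -> 'rV[R]_n) : Prop :=
  forall X Y Z, vfield X -> vfield Y -> vfield Z -> forall p,
    cov_metric g D X Y Z p = 0.

Definition negative_definite_on k n (h : 'rV[R]_n -> 'rV[R]_n -> R)
    (A : 'M[R]_(k, n)) : Prop :=
  forall u : 'rV[R]_n, (u <= A)%MS -> u != 0 -> h u u < 0.

(* q is the largest dimension of a negative definite subspace *)
Definition form_index n (h : 'rV[R]_n -> 'rV[R]_n -> R) (q : nat) : Prop :=
  (exists A : 'M[R]_(q, n), row_free A /\ negative_definite_on h A) /\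
  (forall k (A : 'M[R]_(k, n)), row_free A -> negative_definite_on h A ->
     (k <= q)%N).

Record semi_riemannian n (M : smoothManifold R n)
    (g : M -> 'rV[R]_n -> 'rV[R]_n -> R) : Prop := {
  metric_linear : forall p a u v w,
    g p (a *: u + v) w = a * g p u w + g p v w;
  metric_sym : forall p u v, g p u v = g p v u;
  metric_nondeg : forall p u, (forall v, g p u v = 0) -> u = 0;
  metric_index : exists q, forall p, form_index (g p) q;
  metric_smooth : forall X Y, vfield X -> vfield Y ->
    smooth_fun (fun p => g p (X p) (Y p))
}.

Record statistical_manifold n (M : smoothManifold R n)
    (g : M -> 'rV[R]_n -> 'rV[R]_n -> R)
    (nabla nablas : (M -> 'rV[R]_n) -> (M -> 'rV[R]_n) -> M -> 'rV[R]_n)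
    : Prop := {
  stat_metric : semi_riemannian g;
  stat_connection : affine_connection nabla;
  stat_torsion : torsion_free nabla;
  stat_codazzi : forall X Y Z, vfield X -> vfield Y -> vfield Z -> forall p,
    cov_metric g nabla X Y Z p = cov_metric g nabla Y X Z p;
  stat_dual_connection : affine_connection nablas;
  stat_dual : forall X Y Z, vfield X -> vfield Y -> vfield Z -> forall p,
    dirD p (X p) (fun q => g q (Y q) (Z q)) =
    g p (nabla X Y p) (Z p) + g p (Y p) (nablas X Z p)
}.

Section Hypersurface.
Variables (n : nat) (Mb : smoothManifold R n.+2) (M : smoothManifold R n.+1).
Variables (gb : Mb -> 'rV[R]_n.+2 -> 'rV[R]_n.+2 -> R) (F : M -> Mb).

Definition induced_metric (p : M) (u v : 'rV[R]_n.+1) : R :=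
  gb (F p) (tmap F p u) (tmap F p v).

Definition radical (p : M) : set 'rV[R]_n.+1 :=
  [set u | forall v, induced_metric p u v = 0].

Definition lightlike_hypersurface : Prop :=
  immersion F /\ forall p, exists u, u != 0 /\ radical p u.

Definition screen_distribution (S : M -> set 'rV[R]_n.+1) : Prop :=
  [/\ distribution n S,
      forall p u, S p u -> (forall v, S p v -> induced_metric p u v = 0) ->
        u = 0,
      forall p u, exists r s, [/\ radical p r, S p s & u = r + s] &
      forall p u, radical p u -> S p u -> u = 0].

(* nu is the value at p of the field N attached to the screen distribution S
   and to a section of the radical with value x at p *)
Definition transversal (S : M -> set 'rV[R]_n.+1) (p : M) (x : 'rV[R]_n.+1)
    (nu : 'rV[R]_n.+2) : Prop :=
  [/\ gb (F p) nu nu = 0, gb (F p) nu (tmap F p x) = 1 &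
      forall w, S p w -> gb (F p) nu (tmap F p w) = 0].

(* Gauss formula D_X Y = nabla_X Y + B(X, Y) N. Rescaling xi rescales N and B
   inversely, so nabla does not depend on xi and is defined on all of M even if
   the nowhere-zero section xi of the radical is only local; b is B(X, Y). *)
Definition induced_connection (S : M -> set 'rV[R]_n.+1)
    (D : (M -> 'rV[R]_n.+1) -> (M -> 'rV[R]_n.+2) -> M -> 'rV[R]_n.+2)
    (nabla : (M -> 'rV[R]_n.+1) -> (M -> 'rV[R]_n.+1) -> M -> 'rV[R]_n.+1)
    : Prop :=
  forall X Y, vfield X -> vfield Y ->
    vfield (nabla X Y) /\
    forall p x nu, x != 0 -> radical p x -> transversal S p x nu ->
      exists b : R,
        D X (fun q => tmap F q (Y q)) p = tmap F p (nabla X Y p) + b *: nu.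

(* nabla_X W = nablaS_X W + C(X, W) xi; c is C(X, W) *)
Definition screen_connection (S : M -> set 'rV[R]_n.+1)
    (nabla nablaS : (M -> 'rV[R]_n.+1) -> (M -> 'rV[R]_n.+1) -> M -> 'rV[R]_n.+1)
    : Prop :=
  forall X W, vfield X -> section_of S W ->
    section_of S (nablaS X W) /\
    forall p x, x != 0 -> radical p x ->
      exists c : R, nabla X W p = nablaS X W p + c *: x.

End Hypersurface.

Definition parallel n (M : smoothManifold R n) (D : M -> set 'rV[R]_n)
    (nabla : (M -> 'rV[R]_n) -> (M -> 'rV[R]_n) -> M -> 'rV[R]_n) : Prop :=
  forall X Y, vfield X -> section_of D Y -> section_of D (nabla X Y).

Definition difference_tensor n (M : smoothManifold R n)
    (nabla nablas : (M -> 'rV[R]_n) -> (M -> 'rV[R]_n) -> M -> 'rV[R]_n)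
    (X Y : M -> 'rV[R]_n) (p : M) : 'rV[R]_n :=
  2^-1 *: (nabla X Y p - nablas X Y p).

End Manifolds.

(* Main.v *)
(* The defect of the identity X g(V,W) = g(D_X V, W) + g(V, D*_X W) is tensorial
   in V and W, so on sections of the pulled-back tangent bundle it may be tested
   on restrictions of ambient fields, where it vanishes by duality. On the screen
   S the transversal components drop out, hence
     X g(V,W) = g(nabla_X V, W) + g(V, nabla*_X W)   for V, W in S.
   Since S is nondegenerate and parallel, nabla is metric along S iff nabla and
   nabla* agree on S, and the same holds for nabla*. Along the radical, which is
   parallel, nabla is always metric; and every tangent field is, up to a smooth
   factor not vanishing at a given point, a sum of a section of S and a section
   of the radical. *)
Require Import Defs.
From HB Require Import structures.
From mathcomp Require Import all_boot all_order all_algebra.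
From mathcomp Require Import all_classical all_reals all_analysis.
From mathcomp Require Import ring lra.
Import Order.TTheory GRing.Theory Num.Theory.
Import numFieldNormedType.Exports.
Local Open Scope classical_set_scope.
Local Open Scope ring_scope.

(** * Calculus of C^k maps *)

(** Connections are operators on global fields, and their rules are stated for global smooth
    functions and sections, so an argument cannot be localized by restriction. Every local object
    (coordinate fields, frames of the screen) is multiplied by a bump function and extended by 0,
    and an identity is proved at one point [p] for the field times a global function that does not
    vanish at [p]. Hence the calculus of [Ck] maps below, which goes as far as bump functions. The
    other obstacle is that the induced connections are known only through the Gauss formula, and
    only in the presence of a null transversal vector. Such a vector has to be produced at each
    point; additivity and the Leibniz rule in the differentiated field then follow by comparing
    tangential parts. Both xi and N enter pointwise, so no smooth choice of them is made. *)

Lemma differentiable_near_eq {R : numFieldType} {V W : normedModType R}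
    (f g : V -> W) (x : V) :
  (\forall y \near x, f y = g y) -> differentiable f x ->
  differentiable g x /\ 'd g x = 'd f x :> (V -> W).
Proof.
move=> fg /diff_locallyP [cdf ef].
have eg : g \o shift x = cst (g x) + 'd f x +o_ 0 id.
  apply/eqaddoP => _/posnumP[e]; move/eqaddoP: ef => /(_ e%:num (gt0 _)) ef.
  have fgx := nbhs_singleton fg.
  have: \forall h \near 0, f (h + x) = g (h + x).
    by move: fg; rewrite (near_shift 0) subr0; apply.
  by move=> fg0; near=> h; rewrite !fctE/= -fgx -(near fg0 h)//; near: h.
have dg := diff_unique cdf eg; split; last exact: dg.
by apply/diff_locallyP; rewrite dg.
Unshelve. all: by end_near. Qed.

Section Ck_calculus.
Context {R : realType}.
Implicit Types (U V W : normedModType R).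

Lemma Ck_eq {V W} k (A : set V) (f g : V -> W) : open A ->
  (forall x, A x -> f x = g x) -> Ck k A f -> Ck k A g.
Proof.
move=> oA; elim: k f g => [|k IHk] f g fg /=.
  move=> cf x Ax; have nfg : \forall y \near x, f y = g y.
    by apply: filterS (open_nbhs_nbhs (conj oA Ax)).
  rewrite /prop_for /continuous_at -(fg _ Ax).
  by apply: cvg_trans (cf _ Ax); exact: near_eq_cvg.
move=> [df cdf]; split=> [x Ax|v].
  apply: (differentiable_near_eq f g x _ (df x Ax)).1.
  by apply: filterS (open_nbhs_nbhs (conj oA Ax)).
apply: IHk (cdf v) => x Ax; apply: near_eq_derive.
by apply: filterS (open_nbhs_nbhs (conj oA Ax)).
Qed.

Lemma Ck_sub {V W} k (A B : set V) (f : V -> W) : A `<=` B ->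
  Ck k B f -> Ck k A f.
Proof.
by move=> AB; elim: k f => [|k IHk] f /=; [move=> cf x /AB; exact: cf|
  move=> [df cdf]; split=> [x /AB|v]; [exact: df|exact: IHk]].
Qed.

(** In [Ck] the set only lists the points at which the iterated derivatives of a total map are
    tested, so a pointwise cover suffices. *)
Lemma Ck_cover {V W} k (A : set V) (B : V -> set V) (f : V -> W) :
  (forall x, A x -> B x x /\ Ck k (B x) f) -> Ck k A f.
Proof.
elim: k f => [|k IHk] f /= AB; first by move=> x /[dup] Ax /AB[? ]; exact.
split=> [x /AB[Bx [+ _]]|v]; first exact.
by apply: IHk => x /AB[Bx [_ ]].
Qed.

Lemma Ck_pred {V W} k (A : set V) (f : V -> W) : Ck k.+1 A f -> Ck k A f.
Proof.
elim: k f => [|k IHk] f.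
  by move=> [df _] x /df; exact: differentiable_continuous.
by move=> [df cdf]; split=> // v; exact: IHk.
Qed.

Lemma Ck_cst {V W} k (A : set V) (c : W) : Ck k A (fun=> c).
Proof.
elim: k c => [|k IHk] c /=; first by move=> *; exact: cst_continuous.
split=> [*|v]; first exact: differentiable_cst.
suff -> : (fun x : V => 'D_v (fun=> c) x) = fun=> 0 by [].
by apply/funext => x; rewrite derive_cst.
Qed.

Lemma CkD {V W} k (A : set V) (f g : V -> W) : open A ->
  Ck k A f -> Ck k A g -> Ck k A (fun x => f x + g x).
Proof.
move=> oA; elim: k f g => [|k IHk] f g /=.
  by move=> cf cg x Ax; apply: continuousD; [exact: cf|exact: cg].
move=> [df cdf] [dg cdg]; split=> [x Ax|v].
  by apply: differentiableD; [exact: df|exact: dg].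
apply: Ck_eq (IHk _ _ (cdf v) (cdg v)) => // x Ax.
by rewrite [RHS]deriveD//; apply: diff_derivable; [exact: df|exact: dg].
Qed.

Lemma Ck_sum {V W} k (A : set V) (I : Type) (r : seq I) (f : I -> V -> W) :
  open A -> (forall i, Ck k A (f i)) ->
  Ck k A (fun x => \sum_(i <- r) f i x).
Proof.
move=> oA cf; elim: r => [|i r IHr].
  by apply: Ck_eq (Ck_cst k A 0) => // x _; rewrite big_nil.
by apply: Ck_eq (CkD _ _ _ _ oA (cf i) IHr) => // x _; rewrite big_cons.
Qed.

Lemma CkM {V} k (A : set V) (f g : V -> R^o) : open A ->
  Ck k A f -> Ck k A g -> Ck k A (fun x => f x * g x : R^o).
Proof.
move=> oA; elim: k f g => [|k IHk] f g.
  by move=> cf cg x Ax; apply: continuousM; [exact: cf|exact: cg].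
move=> /[dup] /Ck_pred cf [df cdf] /[dup] /Ck_pred cg [dg cdg].
split=> [x Ax|v].
  by apply: differentiableM; [exact: df|exact: dg].
apply: Ck_eq (CkD _ _ _ _ oA (IHk _ _ cf (cdg v)) (IHk _ _ cg (cdf v))) => //.
move=> x Ax; rewrite [RHS]deriveM//; apply: diff_derivable.
  exact: df.
exact: dg.
Qed.

Lemma Ck_prod {V} k (A : set V) (I : Type) (r : seq I) (f : I -> V -> R^o) :
  open A -> (forall i, Ck k A (f i)) ->
  Ck k A (fun x => \prod_(i <- r) f i x : R^o).
Proof.
move=> oA cf; elim: r => [|i r IHr].
  by apply: Ck_eq (Ck_cst k A (1 : R^o)) => // x _; rewrite big_nil.
by apply: Ck_eq (CkM _ _ _ _ oA (cf i) IHr) => // x _; rewrite big_cons.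
Qed.

Lemma CkV {V} k (A : set V) (f : V -> R^o) : open A ->
  (forall x, A x -> f x != 0) -> Ck k A f -> Ck k A (fun x => (f x)^-1 : R^o).
Proof.
move=> oA f0; elim: k f f0 => [|k IHk] f f0.
  by move=> cf x Ax; apply: cvgV; [exact: f0|exact: cf].
move=> /[dup] /Ck_pred cf [df cdf]; split=> [x Ax|v].
  by apply: differentiableV; [exact: df|exact: f0].
have cV := IHk _ f0 cf.
have := CkM _ _ _ _ oA (CkM _ _ _ _ oA (Ck_cst k A (-1 : R^o)) (cdf v))
  (CkM _ _ _ _ oA cV cV).
apply: Ck_eq => // x Ax; rewrite deriveV ?f0//; last first.
  by apply: diff_derivable; exact: df.
rewrite /GRing.scale/= expr2 invfM; ring.
Qed.

Lemma Ck_coord {V} {m} k (A : set V) (f : V -> 'rV[R]_m) i : open A ->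
  Ck k A f -> Ck k A (fun x => f x 0 i : R^o).
Proof.
move=> oA; elim: k f => [|k IHk] f.
  move=> cf x Ax; apply: (@continuous_comp _ _ _ f (fun u : 'rV_m => u 0 i)).
    exact: cf.
  exact: coord_continuous.
move=> [df cdf]; split=> [x Ax|v].
  apply: (@differentiable_comp _ _ _ _ f (fun u : 'rV_m => u 0 i)).
    exact: df.
  exact: differentiable_coord.
apply: Ck_eq (IHk _ (cdf v)) => // x Ax.
by rewrite derive_mx ?mxE//; apply: diff_derivable; exact: df.
Qed.

Lemma Ck_rV {V} {m} k (A : set V) (f : V -> 'rV[R]_m) : open A ->
  (forall i, Ck k A (fun x => f x 0 i : R^o)) -> Ck k A f.
Proof.
move=> oA; elim: k f => [|k IHk] f cf.
  have -> : f = fun x => \sum_i f x 0 i *: delta_mx 0 i.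
    by apply/funext => y; rewrite -row_sum_delta.
  by apply: (Ck_sum 0) => // i x Ax; apply: continuousZr_tmp; exact: cf.
have df x : A x -> differentiable f x.
  move=> Ax.
  have -> : f = \sum_i (fun x => f x 0 i *: delta_mx 0 i).
    by apply/funext => y; rewrite fct_sumE -row_sum_delta.
  apply: differentiable_sum => i; apply: differentiableZl.
  by have [+ _] := cf i; exact.
split=> // v; apply: IHk => i; have [_ /(_ v)] := cf i.
apply: Ck_eq => // x Ax; rewrite derive_mx ?mxE//.
by apply: diff_derivable; exact: df.
Qed.

(** Induction by the chain rule in coordinates: ['D_v (f \o g)] is the sum of the products of
    [('D_v g) 0 i] with the i-th partial derivative of [f] composed with [g]. The target is scalar
    so that [CkM] applies; vector targets are recovered coordinatewise in [Ck_comp_rV]. *)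
Lemma Ck_comp {V} {m} k (A : set V) (B : set 'rV[R]_m) (g : V -> 'rV[R]_m)
    (f : 'rV[R]_m -> R^o) : open A -> (forall x, A x -> B (g x)) ->
  Ck k A g -> Ck k B f -> Ck k A (f \o g).
Proof.
move=> oA gAB; elim: k f => [|k IHk] f.
  move=> cg cf x Ax; apply: continuous_comp; first exact: cg.
  by apply: cf; exact: gAB.
move=> /[dup] /Ck_pred cg [dg cdg] [df cdf]; split=> [x Ax|v].
  by apply: differentiable_comp; [exact: dg|exact/df/gAB].
have := Ck_sum k A 'I_m (index_enum _) (fun i x => ('D_v g x) 0 i *
  'D_(delta_mx 0 i) f (g x) : R^o) oA.
move=> ck; apply: Ck_eq (ck _) => // [x Ax|i]; last first.
  have := IHk _ cg (cdf (delta_mx 0 i)); apply: CkM => //.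
  exact: (Ck_coord k A (fun x => 'D_v g x) i oA (cdg v)).
have dfx := df _ (gAB _ Ax); have dgx := dg _ Ax.
rewrite [RHS]deriveE; last exact: differentiable_comp.
rewrite [RHS](congr1 (@^~ v) (diff_comp dgx dfx))/= -(deriveE _ dgx).
rewrite {2}(row_sum_delta ('D_v g x)) linear_sum/=.
by apply: eq_bigr => i _; rewrite linearZ/= (deriveE _ dfx).
Qed.

(** The variant with [R^o] in the middle, which is not a row space; it serves to compose with
    [flat_exp]. *)
Lemma Ck_compR {V} k (A : set V) (B : set R^o) (g : V -> R^o)
    (f : R^o -> R^o) : open A -> (forall x, A x -> B (g x)) ->
  Ck k A g -> Ck k B f -> Ck k A (f \o g).
Proof.
move=> oA gAB; elim: k f => [|k IHk] f.
  move=> cg cf x Ax; apply: continuous_comp; first exact: cg.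
  by apply: cf; exact: gAB.
move=> /[dup] /Ck_pred cg [dg cdg] [df cdf]; split=> [x Ax|v].
  by apply: differentiable_comp; [exact: dg|exact/df/gAB].
have := CkM _ _ _ _ oA (cdg v) (IHk _ cg (cdf 1)).
apply: Ck_eq => // x Ax.
have dfx := df _ (gAB _ Ax); have dgx := dg _ Ax.
rewrite [RHS]deriveE; last exact: differentiable_comp.
rewrite [RHS](congr1 (@^~ v) (diff_comp dgx dfx))/= (deriveE _ dgx).
rewrite (deriveE _ dfx).
by rewrite -[X in _ = _ X]mulr1 -[_ * 1]/(_ *: (1 : R^o)) linearZ.
Qed.

Lemma Ck_id k {m} (A : set 'rV[R]_m) : Ck k A id.
Proof.
case: k => [|k] /=; first by move=> x _.
split=> // v; have -> : (fun x => 'D_v (@id 'rV[R]_m) x) = fun=> v.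
  by apply/funext => x; rewrite derive_id.
exact: Ck_cst.
Qed.

Lemma Cinfty_diff {V W} (A : set V) (f : V -> W) x :
  Cinfty A f -> A x -> differentiable f x.
Proof. by move=> /(_ 1%N)[+ _]; exact. Qed.

(** For [m = 0] this is the classical flat function exp(-1/x), extended by 0. The factor [x ^- m]
    makes the span of the family stable under differentiation. *)
Definition flat_exp (m : nat) (x : R) : R :=
  if 0 < x then x ^- m * expR (- x^-1) else 0.

(* The bound [y^(m+1) exp(-y) <= (m+2)! / y], with [y = 1 / x]. *)
Lemma flat_exp_le m x : `|x^-1 * flat_exp m x| <= (m.+2)`!%:R * `|x|.
Proof.
rewrite /flat_exp; case: ltP => [x0|_]; last by rewrite mulr0 normr0 mulr_ge0.
rewrite mulrA -exprVn -exprS (ger0_norm (ltW x0)) ger0_norm; last first.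
  by rewrite mulr_ge0 ?expR_ge0// exprn_ge0// invr_ge0 ltW.
have y0 : 0 <= x^-1 by rewrite invr_ge0 ltW.
have := expR_ge1Dxn m.+1 y0; set E := expR _ => hE.
rewrite expRN -/E ler_pdivrMr ?expR_gt0//.
have hF : 0 < (m.+2)`!%:R :> R by rewrite ltr0n fact_gt0.
have {hE} : x^-1 ^+ m.+2 / (m.+2)`!%:R <= E by apply: le_trans hE; rewrite lerDr.
rewrite ler_pdivrMr// => hE.
have -> : x^-1 ^+ m.+1 = x * x^-1 ^+ m.+2.
  by rewrite [in RHS]exprS mulrA divff ?mul1r// gt_eqF.
by rewrite [_ * x]mulrC -mulrA ler_pM2l// mulrC.
Qed.

(** Away from 0 this is the product rule, or the derivative of a locally zero function. At 0 the
    difference quotient is [h^-1 * flat_exp m h], which [flat_exp_le] bounds by a multiple of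
    [|h|]. *)
Lemma derivable_flat_exp m (x : R^o) :
  is_derive (x : R^o) (1 : R^o) (flat_exp m : R^o -> R^o)
    (flat_exp m.+2 x - m%:R * flat_exp m.+1 x).
Proof.
have [x0|x0|->] := ltgtP x 0.
- apply: (@near_eq_is_derive _ _ _ (fun=> 0 : R^o)).
    near=> y; rewrite /flat_exp ifN// -leNgt ltW//.
    by near: y; exact: lt_nbhsl.
  rewrite /flat_exp ifN -?leNgt ?ltW// ifN -?leNgt ?ltW// mulr0 subr0.
  exact: is_derive_cst.
- apply: (@near_eq_is_derive _ _ _ (fun y : R => y^-1 ^+ m * expR (- y^-1) : R^o)).
    near=> y; rewrite /flat_exp ifT ?exprVn//.
    by near: y; exact: lt_nbhsr.
  rewrite /flat_exp x0.
  have xn0 : x != 0 by rewrite gt_eqF.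
  have dV : is_derive x 1 (fun y : R => y^-1) (- x ^- 2).
    by have := @is_deriveV _ id x 1 1 xn0 (is_derive_id _ _); rewrite scaler1.
  have dE : is_derive x 1 (fun y : R => expR (- y^-1)) (x ^- 2 * expR (- x^-1)).
    by rewrite -[x ^- 2]opprK mulrC; apply: (@is_derive1_comp _ expR).
  have dX : is_derive x 1 (fun y : R => y^-1 ^+ m)
      (m%:R * x^-1 ^+ m.-1 * - x ^- 2).
    have := is_deriveX m dV.
    rewrite (_ : _ ^+ m = fun y : R => y^-1 ^+ m)//.
    by apply/funext => y; rewrite fctE.
  have [cvgD valD] := is_deriveM dX dE; split; first exact: cvgD.
  rewrite [LHS]valD.
  rewrite /GRing.scale/= -!exprVn; set y := x^-1; set E := expR _.
  case: (m) => [|k]; first by rewrite /=; ring.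
  rewrite /= !exprS; ring.
- rewrite /flat_exp ltxx mulr0 subr0.
  have lim0 : (fun h : R =>
      h^-1 *: ((flat_exp m \o shift (0 : R)) (h *: 1) - flat_exp m 0)) @ 0^'
      --> (0 : R).
    apply/cvgrPdist_le => e e0; near=> h.
    rewrite /= addr0 sub0r normrN [h *: 1]mulr1.
    rewrite {2}/flat_exp ltxx subr0.
    apply: le_trans (flat_exp_le m h) _.
    rewrite -ler_pdivlMl ?ltr0n ?fact_gt0//.
    by near: h; apply: dnbhs0_le; rewrite mulr_gt0// invr_gt0 ltr0n fact_gt0.
  by split; [apply/cvg_ex; exists 0; exact: lim0|exact: cvg_lim lim0].
Unshelve. all: by end_near.
Qed.

Lemma Ck_flat_exp k m (A : set R^o) : open A ->
  Ck k A (flat_exp m : R^o -> R^o).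
Proof.
move=> oA; elim: k m => [|k IHk] m.
  move=> x _; apply: differentiable_continuous; apply/derivable1_diffP.
  by have [] := derivable_flat_exp m x.
have df x : differentiable (flat_exp m : R^o -> R^o) x.
  by apply/derivable1_diffP; have [] := derivable_flat_exp m x.
split=> // v.
have := CkM k A _ _ oA (Ck_cst k A (v : R^o)) (CkD k A _ _ oA (IHk m.+2) (CkM k A _ _ oA
  (Ck_cst k A (- m%:R : R^o)) (IHk m.+1))).
apply: Ck_eq => // x _.
rewrite deriveE// -[X in _ = _ X]mulr1 -[_ * 1]/(_ *: (1 : R^o)) linearZ/= -deriveE//.
have [_ ->] := derivable_flat_exp m x.
by rewrite mulNr.
Qed.

End Ck_calculus.

(** * Smooth functions and bump functions *)

Section Cinfty_calculus.
Context {R : realType}.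
Implicit Types (V W : normedModType R).

Lemma Ck_comp_rV {V} {m l} k (A : set V) (B : set 'rV[R]_m)
    (g : V -> 'rV[R]_m) (f : 'rV[R]_m -> 'rV[R]_l) : open A -> open B ->
  (forall x, A x -> B (g x)) -> Ck k A g -> Ck k B f -> Ck k A (f \o g).
Proof.
move=> oA oB gAB cg cf; apply: Ck_rV => // i.
by apply: (Ck_comp k A B g (fun y => f y 0 i)) => //; exact: Ck_coord.
Qed.

Lemma Cinfty_derive {V W} (A : set V) (f : V -> W) v :
  Cinfty A f -> Cinfty A (fun x => 'D_v f x).
Proof. by move=> cf k; have [_] := cf k.+1; exact. Qed.

Lemma Cinfty_sub {V W} (A B : set V) (f : V -> W) : A `<=` B ->
  Cinfty B f -> Cinfty A f.
Proof. by move=> AB cf k; exact: Ck_sub AB (cf k). Qed.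

End Cinfty_calculus.

Section Smooth_functions.
Context {R : realType} {n : nat} {M : smoothManifold R n}.
Implicit Types (U O : set M) (W : normedModType R).

Lemma open_chart_image U i : open U ->
  open (chart i @` (chart_dom i `&` U)).
Proof.
move=> oU; rewrite openE => _ [p [ip Up] <-].
have ni : nbhs (chart i p) (chart i @` chart_dom i).
  by apply: open_nbhs_nbhs; split; [exact: chart_image_open|exists p].
have nU : nbhs (chart i p) (chart_inv i @^-1` U).
  apply: (chart_inv_continuous ip); rewrite chartK//.
  exact: open_nbhs_nbhs.
apply: filterS (filterI ni nU) => _ [[q iq <-]] /=.
by rewrite chartK// => Uq; exists q.
Qed.

Lemma smooth_fun_on_eq {W} U (f g : M -> W) : open U ->
  (forall p, U p -> f p = g p) -> smooth_fun_on U f -> smooth_fun_on U g.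
Proof.
move=> oU fg sf i k; apply: Ck_eq (sf i k); first exact: open_chart_image.
by move=> _ [p [ip Up] <-] /=; rewrite chartK// fg.
Qed.

Lemma smooth_fun_on_sub {W} U U' (f : M -> W) : U `<=` U' ->
  smooth_fun_on U' f -> smooth_fun_on U f.
Proof.
by move=> UU' sf i; apply: Cinfty_sub (sf i); apply: image_subset; exact: setIS.
Qed.

Lemma smooth_fun_on_cover {W} U (f : M -> W) :
  (forall p, U p -> exists O, O p /\ smooth_fun_on O f) -> smooth_fun_on U f.
Proof.
move=> cov i k.
(* [Ck_cover] expects the covering set as a function of the coordinate point, so one admissible [O]
   is chosen for each; the default [set0] never occurs over [U]. *)
pose B x := chart i @` (chart_dom i `&`
  xget set0 [set O | O (chart_inv i x) /\ smooth_fun_on O f]).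
apply: (Ck_cover _ _ B) => _ [p [ip Up] <-].
rewrite /B chartK//; case: xgetP => [Q _ [Qp sQ]|none]; last first.
  by have [Q QP] := cov p Up; case: (none Q).
by split; [exists p|exact: sQ].
Qed.

Lemma smooth_cst {W} U (c : W) : smooth_fun_on U (fun=> c).
Proof. by move=> i k; exact: Ck_cst. Qed.

Lemma smoothD {W} U (f g : M -> W) : open U -> smooth_fun_on U f ->
  smooth_fun_on U g -> smooth_fun_on U (fun p => f p + g p).
Proof.
by move=> oU sf sg i k; apply: CkD; [exact: open_chart_image|exact: sf|exact: sg].
Qed.

Lemma smooth_sum {W} U (I : Type) (r : seq I) (f : I -> M -> W) : open U ->
  (forall i, smooth_fun_on U (f i)) ->
  smooth_fun_on U (fun p => \sum_(i <- r) f i p).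
Proof.
move=> oU sf j k; apply: (Ck_sum k _ I r (fun i x => f i (chart_inv j x))).
  exact: open_chart_image.
by move=> i; exact: sf.
Qed.

Lemma smoothM U (f g : M -> R^o) : open U -> smooth_fun_on U f ->
  smooth_fun_on U g -> smooth_fun_on U (fun p => f p * g p : R^o).
Proof.
move=> oU sf sg i k.
apply: (CkM k _ (fun x => f (chart_inv i x)) (fun x => g (chart_inv i x))).
- exact: open_chart_image.
- exact: sf.
- exact: sg.
Qed.

Lemma smooth_prod U (I : Type) (r : seq I) (f : I -> M -> R^o) : open U ->
  (forall i, smooth_fun_on U (f i)) ->
  smooth_fun_on U (fun p => \prod_(i <- r) f i p : R^o).
Proof.
move=> oU sf j k; apply: (Ck_prod k _ I r (fun i x => f i (chart_inv j x))).
  exact: open_chart_image.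
by move=> i; exact: sf.
Qed.

Lemma smoothV U (f : M -> R^o) : open U -> (forall p, U p -> f p != 0) ->
  smooth_fun_on U f -> smooth_fun_on U (fun p => (f p)^-1 : R^o).
Proof.
move=> oU f0 sf i k; apply: (CkV k _ (fun x => f (chart_inv i x))).
- exact: open_chart_image.
- by move=> _ [p [ip Up] <-]; rewrite chartK// f0.
- exact: sf.
Qed.

Lemma smooth_det U m (A : M -> 'M[R]_m) : open U ->
  (forall i j, smooth_fun_on U (fun p => A p i j : R^o)) ->
  smooth_fun_on U (fun p => \det (A p) : R^o).
Proof.
move=> oU sA; rewrite /determinant; apply: smooth_sum => // s.
apply: smoothM => //; first exact: smooth_cst.
exact: smooth_prod.
Qed.

Lemma smooth_adj U m (A : M -> 'M[R]_m) k l : open U ->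
  (forall i j, smooth_fun_on U (fun p => A p i j : R^o)) ->
  smooth_fun_on U (fun p => (\adj (A p)) k l : R^o).
Proof.
move=> oU sA.
apply: (smooth_fun_on_eq _ (fun p => cofactor (A p) l k : R^o)) => //.
  by move=> p _; rewrite mxE.
apply: (smoothM U (fun=> (-1) ^+ (l + k))) => //; first exact: smooth_cst.
apply: (smooth_det U _ (fun p => row' l (col' k (A p)))) => // i j.
by apply: smooth_fun_on_eq (sA (lift l i) (lift k j)) => // p _; rewrite !mxE.
Qed.

Lemma smooth_coordP {m} U (f : M -> 'rV[R]_m) : open U ->
  smooth_fun_on U f <-> forall k, smooth_fun_on U (fun p => f p 0 k : R^o).
Proof.
move=> oU; split=> [sf k i l|sf i l].
  apply: (Ck_coord l _ (f \o chart_inv i)); first exact: open_chart_image.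
  exact: sf.
by apply: Ck_rV => [|k]; [exact: open_chart_image|exact: sf].
Qed.

Lemma smooth_fun_continuous {W} U (f : M -> W) p : open U -> U p ->
  smooth_fun_on U f -> {for p, continuous f}.
Proof.
move=> oU Up sf; have ip := idx_dom p.
have cf : {for chart (idx p) p, continuous (f \o chart_inv (idx p))}.
  by apply: (sf (idx p) 0%N); exists p.
have := continuous_comp (chart_continuous ip) cf.
rewrite /prop_for /continuous_at /= chartK//; apply: cvg_trans.
apply: near_eq_cvg.
have nd : nbhs p (chart_dom (idx p)).
  by apply: open_nbhs_nbhs; split=> //; exact: chart_dom_open.
by apply: filterS nd => q iq /=; rewrite chartK.
Qed.

Lemma smooth_fun_chart (i : chart_index M) (f : 'rV[R]_n -> R^o) : Cinfty setT f ->
  smooth_fun_on (chart_dom i) (f \o chart i).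
Proof.
move=> cf j k; apply: (Ck_comp k _ setT (chart i \o chart_inv j)) => //.
  by apply: open_chart_image; exact: chart_dom_open.
exact: chart_transition.
Qed.

Lemma smooth_fun_diff {W} U (f : M -> W) i p : U p -> chart_dom i p ->
  smooth_fun_on U f -> differentiable (f \o chart_inv i) (chart i p).
Proof. by move=> Up ip sf; apply: Cinfty_diff (sf i) _; exists p. Qed.

(** The norm of a row vector is the maximum of its coordinates, so a ball is a cube and a product of
    one-dimensional bumps is supported in it. *)
Lemma bump_rV (c : 'rV[R]_n) (r : R) : 0 < r ->
  exists f : 'rV[R]_n -> R^o, [/\ Cinfty setT f, f c = 1 &
    forall x, f x != 0 -> `|c - x| <= r].
Proof.
move=> r0.
pose f (x : 'rV[R]_n) : R^o := \prod_k
  (flat_exp 0 (r + (x 0 k - c 0 k)) * flat_exp 0 (r - (x 0 k - c 0 k))).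
have fc : f c != 0.
  apply/prodf_neq0 => k _; rewrite subrr addr0 subr0 /flat_exp r0.
  by rewrite !mulf_neq0 ?invr_neq0 ?expf_neq0 ?oner_eq0// gt_eqF// expR_gt0.
exists (fun x => (f c)^-1 * f x); split.
- move=> l; apply: (CkM l setT (fun=> (f c)^-1)) => //; first exact: openT.
    exact: Ck_cst.
  apply: (Ck_prod l setT _ _ (fun k (x : 'rV[R]_n) =>
   flat_exp 0 (r + (x 0 k - c 0 k)) * flat_exp 0 (r - (x 0 k - c 0 k)) : R^o)).
    exact: openT.
  move=> k; apply: CkM; first exact: openT.
    apply: (Ck_compR l setT setT (fun x : 'rV[R]_n => r + (x 0 k - c 0 k) : R^o)
       (flat_exp 0)) => //; [exact: openT| |exact/Ck_flat_exp/openT].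
    apply: CkD; [exact: openT|exact: Ck_cst|].
    apply: CkD; [exact: openT| |exact: Ck_cst].
    by apply: Ck_coord; [exact: openT|exact: Ck_id].
  apply: (Ck_compR l setT setT (fun x : 'rV[R]_n => r - (x 0 k - c 0 k) : R^o)
     (flat_exp 0)) => //; [exact: openT| |exact/Ck_flat_exp/openT].
  apply: CkD; [exact: openT|exact: Ck_cst|].
  apply: (Ck_eq l setT (fun x : 'rV[R]_n => -1 * (x 0 k - c 0 k) : R^o));
    [exact: openT|by move=> x _; rewrite mulN1r|].
  apply: CkM; [exact: openT|exact: Ck_cst|].
  apply: CkD; [exact: openT| |exact: Ck_cst].
  by apply: Ck_coord; [exact: openT|exact: Ck_id].
- by rewrite mulVf.
- move=> x; rewrite mulf_eq0 negb_or => /andP[_ /prodf_neq0 fx].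
  rewrite [leLHS]/Num.Def.normr/= mx_normrE (bigmax_le _ (ltW r0))//= => -[i k] _.
  rewrite !mxE/= (ord1 i); have := fx k isT; rewrite mulf_eq0 negb_or /flat_exp.
  case: ltP => [h1|_]; last by rewrite eqxx.
  case: ltP => [h2 _|_]; last by rewrite eqxx andbF.
  by rewrite ler_norml; apply/andP; split; lra.
Qed.

(** Extension by 0 is smooth because the complement of [K] is open: [K] is the image of a compact
    ball under the inverse chart, hence closed since the manifold is Hausdorff. Halving the radius
    puts the closed ball inside the open one. *)
Lemma bump U p : open U -> U p -> exists (phi : M -> R) (K : set M),
  [/\ smooth_fun phi, phi p = 1, closed K, K `<=` U &
      forall q, ~ K q -> phi q = 0].
Proof.
move=> oU Up; set i := idx p; have ip : chart_dom i p := idx_dom p.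
have : nbhs (chart i p) (chart i @` (chart_dom i `&` U)).
  by apply: open_nbhs_nbhs; split; [exact: open_chart_image|exists p].
move=> /nbhs_ballP[e /= e0 eU]; have e20 : 0 < e / 2 by rewrite divr_gt0.
have [f [cf fp f0]] := bump_rV (chart i p) _ e20.
pose Kx := closed_ball_ (fun x => `|x|) (chart i p) (e / 2).
have KxU : Kx `<=` chart i @` (chart_dom i `&` U).
  move=> x Kx_x; apply: eU; rewrite -ball_normE /ball_/=.
  by apply: le_lt_trans Kx_x _; rewrite ltr_pdivrMr// ltr_pMr// ltr1n.
pose K := chart_inv i @` Kx.
have KU q : K q -> chart_dom i q /\ U q.
  by move=> [x /KxU[q' [iq' Uq'] <-] <-]; rewrite chartK.
have cK : closed K.
  apply: compact_closed; first exact: manifold_hausdorff.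
  apply: continuous_compact.
    apply: continuous_in_subspaceT => x /set_mem /KxU [q [iq _] <-].
    exact: chart_inv_continuous.
  apply: bounded_closed_compact; last exact: closed_closed_ball_.
  exists (`|chart i p| + e); split; first exact: num_real.
  move=> y ey x Kx_x; apply: le_trans (ltW ey).
  rewrite -[x](subKr (chart i p)) (le_trans (ler_normB _ _))// lerD2l.
  by apply: le_trans Kx_x _; rewrite ler_pdivrMr// ler_peMr ?ler1n// ltW.
pose phi q := if `[< chart_dom i q >] then f (chart i q) else 0.
have phi0 q : ~ K q -> phi q = 0.
  rewrite /phi; case: asboolP => // iq nK; apply/eqP; apply: contra_notT nK.
  by move=> /f0 h; exists (chart i q) => //; rewrite chartK.
exists phi, K; split=> //.
- apply: smooth_fun_on_cover => q _; have [iq|niq] := pselect (chart_dom i q).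
    exists (chart_dom i); split=> //.
    apply: smooth_fun_on_eq (smooth_fun_chart i f cf).
      exact: chart_dom_open.
    by move=> q' iq'; rewrite /phi asboolT.
  exists (~` K); split; first by move=> /KU[].
  apply: smooth_fun_on_eq (smooth_cst (~` K) (0 : R^o)).
    exact: closed_openC.
  by move=> q' /phi0 ->.
- by rewrite /phi asboolT.
- by move=> q /KU[].
Qed.

(** Outside [U] the values of [f] may be arbitrary: the product vanishes on the open complement of
    [K], which together with [U] covers everything. The set [O] allows use over a chart domain
    only. *)
Lemma smooth_extension U O (phi : M -> R) (K : set M) (f : M -> R) :
  open U -> open O -> smooth_fun phi -> closed K -> K `<=` U ->
  (forall q, ~ K q -> phi q = 0) -> smooth_fun_on (O `&` U) (f : M -> R^o) ->
  smooth_fun_on O (fun q => phi q * f q : R^o).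
Proof.
move=> oU oO sphi cK KU phi0 sf; apply: smooth_fun_on_cover => q Oq.
have [Uq|nUq] := pselect (U q).
  exists (O `&` U); split=> //; apply: smoothM => //; first exact: openI.
  exact: smooth_fun_on_sub sphi.
exists (~` K); split; first by move=> /KU.
apply: smooth_fun_on_eq (smooth_cst (~` K) (0 : R^o)).
  exact: closed_openC.
by move=> q' /phi0 ->; rewrite mul0r.
Qed.

(** Removes the auxiliary factors introduced by bump functions: near [p] one may divide by [psi]. *)
Lemma smooth_of_multiple (f : M -> R) :
  (forall p, exists psi : M -> R, [/\ smooth_fun psi, psi p != 0 &
    smooth_fun (fun q => psi q * f q)]) -> smooth_fun f.
Proof.
move=> h; apply: smooth_fun_on_cover => p _; have [psi [s0 p0 s1]] := h p.
pose U := [set q | psi q != 0].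
have oU : open U.
  rewrite openE => q Uq; have /(_ [set y | y != 0]) :=
    smooth_fun_continuous setT (psi : M -> R^o) q openT I s0.
  by apply; apply: open_nbhs_nbhs; split=> //; exact: open_neq.
exists U; split=> //.
apply: (smooth_fun_on_eq _ (fun q => (psi q)^-1 * (psi q * f q) : R^o)) => //.
  by move=> q Uq; rewrite mulrA mulVf ?mul1r.
apply: smoothM => //; last exact: smooth_fun_on_sub s1.
by apply: smoothV => //; exact: smooth_fun_on_sub s0.
Qed.

End Smooth_functions.

(** * Tangent maps, sections and frames *)

Section Tangent_calculus.
Context {R : realType} {m n : nat}.
Context {M : smoothManifold R m} {N : smoothManifold R n}.
Variable F : M -> N.

Lemma smooth_map_diff i j p : smooth_map F -> chart_dom i p ->
  chart_dom j (F p) ->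
  differentiable (chart j \o F \o chart_inv i) (chart i p).
Proof. by move=> [_ /(_ j) sF] ip jp; exact: smooth_fun_diff sF. Qed.

(** The chain rule through an intermediate chart [j]. Inverse charts are meaningful only on chart
    images, so the two composites agree only near [chart i p], which is enough for their
    differentials. With [F] the identity it gives the changes of coordinates. *)
Lemma chart_chain {W : normedModType R} (g : N -> W) i j p :
  smooth_map F -> chart_dom i p -> chart_dom j (F p) ->
  differentiable (g \o chart_inv j) (chart j (F p)) ->
  differentiable (g \o F \o chart_inv i) (chart i p) /\
  'd (g \o F \o chart_inv i) (chart i p) =
    'd (g \o chart_inv j) (chart j (F p)) \o
    'd (chart j \o F \o chart_inv i) (chart i p) :> (_ -> _).
Proof.
move=> sF ip jp dg; have dF := smooth_map_diff _ _ _ sF ip jp.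
have dg' : differentiable (g \o chart_inv j)
    ((chart j \o F \o chart_inv i) (chart i p)) by rewrite /= chartK.
have nF : \forall x \near chart i p, chart_dom j (F (chart_inv i x)).
  suff: nbhs (chart_inv i (chart i p)) (F @^-1` chart_dom j).
    exact: chart_inv_continuous.
  rewrite chartK//.
  by apply: sF.1; apply: open_nbhs_nbhs; split=> //; exact: chart_dom_open.
have E : \forall x \near chart i p, ((g \o chart_inv j) \o
    (chart j \o F \o chart_inv i)) x = (g \o F \o chart_inv i) x.
  by apply: filterS nF => x jx /=; rewrite chartK.
have [dgF ->] := differentiable_near_eq _ _ _ E (differentiable_comp dF dg').
split; first exact: dgF.
by rewrite (diff_comp dF dg') /= chartK.
Qed.

Lemma smooth_comp U (u : N -> R) : smooth_map F -> open U ->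
  smooth_fun_on U (u : N -> R^o) ->
  smooth_fun_on (F @^-1` U) (u \o F : M -> R^o).
Proof.
move=> sF oU su; apply: smooth_fun_on_cover => p Up.
pose j := idx (F p); have oj : open (chart_dom j) := chart_dom_open j.
have oUj : open (chart_dom j `&` U) by exact: openI.
exists (F @^-1` (chart_dom j `&` U)); split; first by split=> //; exact: idx_dom.
have oP : open (F @^-1` (chart_dom j `&` U)).
  by apply: open_comp => // q _; exact: sF.1.
apply: (smooth_fun_on_eq _ ((u \o chart_inv j) \o (chart j \o F) : M -> R^o)) => //.
  by move=> q [jq _] /=; rewrite chartK.
move=> i k; apply: (Ck_comp k _ (chart j @` (chart_dom j `&` U))
  ((chart j \o F) \o chart_inv i)).
- exact: open_chart_image.
- by move=> _ [q [iq [jq Uq]] <-] /=; exists (F q); rewrite ?chartK.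
- apply: Ck_sub (sF.2 j i k); apply: image_subset => q [iq [jq _]].
  by split.
- exact: su.
Qed.

End Tangent_calculus.

Lemma smooth_map_id {R : realType} {n} (M : smoothManifold R n) :
  smooth_map (fun p : M => p).
Proof.
by split=> [p|j i k]; [exact: cvg_id|exact: chart_transition].
Qed.

Section Tangent_vectors.
Context {R : realType} {m n : nat}.
Context {M : smoothManifold R m} {N : smoothManifold R n}.
Variable F : M -> N.
Hypothesis sF : smooth_map F.

Lemma dirD_comp p v (u : N -> R) : smooth_fun u ->
  dirD p v (u \o F) = dirD (F p) (tmap F p v) u.
Proof.
move=> su; have ip := idx_dom p; have jp := idx_dom (F p).
have du := smooth_fun_diff setT (u : N -> R^o) _ _ I jp su.
by have [_ /(congr1 (@^~ v))] := chart_chain F (u : N -> R^o) _ _ _ sF ip jp du.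
Qed.

Lemma tcoord_tmap i j p v : chart_dom i p -> chart_dom j (F p) ->
  tcoord j (F p) (tmap F p v) =
  'd (chart j \o F \o chart_inv i) (chart i p) (tcoord i p v).
Proof.
move=> ip jp.
have dj : differentiable (chart j \o chart_inv (idx (F p)))
    (chart (idx (F p)) (F p)).
  apply: (smooth_map_diff id); [exact: smooth_map_id|exact: idx_dom|exact: jp].
have [_ /(congr1 (@^~ v)) e1] :=
  chart_chain F (chart j) _ _ _ sF (idx_dom p) (idx_dom (F p)) dj.
have [_ /(congr1 (@^~ v)) e2] := chart_chain id (chart j \o F) _ _ p
  (smooth_map_id M) (idx_dom p) ip (smooth_map_diff F _ _ _ sF ip jp).
exact: etrans (esym e1) e2.
Qed.

End Tangent_vectors.

Section Frames.
Context {R : realType} {n : nat} {N : smoothManifold R n}.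

(** The inverse of [tcoord j q]; for fixed [w] it is the field on [chart_dom j] with constant
    coordinates [w] in the chart [j]. *)
Definition tvec (j : chart_index N) (q : N) (w : 'rV[R]_n) : 'rV[R]_n :=
  'd (chart_at q \o chart_inv j) (chart j q) w.

Lemma chart_transition_diff (i j : chart_index N) q :
  chart_dom i q -> chart_dom j q ->
  differentiable (chart j \o chart_inv i) (chart i q).
Proof. exact: (smooth_map_diff id i j q (smooth_map_id N)). Qed.

Lemma diff_chart_id (i : chart_index N) q : chart_dom i q ->
  'd (chart i \o chart_inv i) (chart i q) = id :> ('rV[R]_n -> 'rV[R]_n).
Proof.
move=> iq; have ni : nbhs (chart i q) (chart i @` chart_dom i).
  by apply: open_nbhs_nbhs; split; [exact: chart_image_open|exists q].
have E : \forall x \near chart i q, id x = (chart i \o chart_inv i) x.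
  by apply: filterS ni => _ [p ip <-] /=; rewrite chartK.
have [d ->] := differentiable_near_eq id _ _ E (@ex_diff _ _ _ _ _ _ _ (is_diff_id _)).
by apply/funext => v; rewrite diff_val.
Qed.

Lemma transition_chain (i j k : chart_index N) q v :
  chart_dom i q -> chart_dom j q -> chart_dom k q ->
  'd (chart k \o chart_inv j) (chart j q)
    ('d (chart j \o chart_inv i) (chart i q) v) =
  'd (chart k \o chart_inv i) (chart i q) v.
Proof.
move=> iq jq kq; have [_ /(congr1 (@^~ v)) e] := chart_chain id (chart k) i j q
  (smooth_map_id N) iq jq (chart_transition_diff _ _ _ jq kq).
exact: esym e.
Qed.

Lemma tcoord_tvec (j k : chart_index N) q w : chart_dom j q -> chart_dom k q ->
  tcoord k q (tvec j q w) = 'd (chart k \o chart_inv j) (chart j q) w.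
Proof. by move=> jq kq; apply: transition_chain => //; exact: idx_dom. Qed.

Lemma tcoordK (j : chart_index N) q : chart_dom j q ->
  cancel (tcoord j q) (tvec j q).
Proof.
move=> jq v; have iq := idx_dom q.
by rewrite /tvec /tcoord transition_chain// diff_chart_id.
Qed.

(** In a chart [k] the coordinates of this field are the derivative of the transition map in the
    constant direction [w]. *)
Lemma smooth_tvec (j : chart_index N) w :
  smooth_section_on (fun q : N => q) (chart_dom j) (tvec j ^~ w).
Proof.
move=> k; have ojk : open (chart_dom j `&` chart_dom k).
  by apply: openI; exact: chart_dom_open.
apply: (smooth_fun_on_eq _ ((fun x => 'D_w (chart k \o chart_inv j) x) \o chart j)).
- exact: ojk.
- move=> q [jq kq] /=.
  by rewrite tcoord_tvec// deriveE//; exact: chart_transition_diff.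
move=> i l; apply: (Ck_comp_rV l _ (chart j @` (chart_dom j `&` chart_dom k))
   (chart j \o chart_inv i) (fun x => 'D_w (chart k \o chart_inv j) x)).
- exact: open_chart_image.
- by apply: open_chart_image; exact: chart_dom_open.
- by move=> _ [q [iq [jq kq]] <-] /=; exists q; rewrite ?chartK.
- apply: Ck_sub (chart_transition i j l); apply: image_subset => q [iq [jq _]].
  by split.
- exact: Cinfty_derive (chart_transition j k) _.
Qed.

End Frames.

Section Sections.
Context {R : realType} {m n : nat}.
Context {M : smoothManifold R m} {N : smoothManifold R n}.
Variable F : M -> N.
Hypothesis sF : smooth_map F.

Lemma open_preimage (U : set N) : open U -> open (F @^-1` U).
Proof. by move=> oU; apply: open_comp => // q _; exact: sF.1. Qed.

Lemma smooth_sectionD V V' : smooth_section F V -> smooth_section F V' ->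
  smooth_section F (fun p => V p + V' p).
Proof.
move=> sV sV' j; have oj := open_preimage _ (chart_dom_open j).
have oTj : open (setT `&` F @^-1` chart_dom j) by rewrite setTI.
apply: (smooth_fun_on_eq _
  (fun p => tcoord j (F p) (V p) + tcoord j (F p) (V' p))) => //.
  by move=> p _; rewrite /tcoord linearD.
by apply: (smoothD _ _ _ oTj); [exact: sV|exact: sV'].
Qed.

Lemma smooth_section_extension U (phi : M -> R) (K : set M) V : open U ->
  smooth_fun phi -> closed K -> K `<=` U -> (forall q, ~ K q -> phi q = 0) ->
  smooth_section_on F U V -> smooth_section F (fun p => phi p *: V p).
Proof.
move=> oU sphi cK KU phi0 sV j; have oj := open_preimage _ (chart_dom_open j).
rewrite setTI; apply/smooth_coordP => // k.
apply: (smooth_fun_on_eq _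
  (fun p => phi p * tcoord j (F p) (V p) 0 k : R^o)) => //.
  by move=> p _; rewrite /tcoord linearZ mxE.
apply: (smooth_extension U _ phi K) => //.
have oUj : open (U `&` F @^-1` chart_dom j) by exact: openI.
by rewrite setIC; move/(smooth_coordP _ _ oUj): (sV j); exact.
Qed.

Lemma smooth_sectionZ (h : M -> R) V : smooth_fun h -> smooth_section F V ->
  smooth_section F (fun p => h p *: V p).
Proof.
move=> sh; apply: (smooth_section_extension setT h setT) => //; first exact: openT.
by move=> q /(_ I).
Qed.

Lemma smooth_section0 : smooth_section F (fun=> 0).
Proof.
move=> j; have oj := open_preimage _ (chart_dom_open j).
apply: (smooth_fun_on_eq _ (fun=> 0)); last exact: smooth_cst.
  by rewrite setTI.
by move=> p _; rewrite /tcoord linear0.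
Qed.

Lemma smooth_section_sum (I : Type) (r : seq I) (V : I -> M -> 'rV[R]_n) :
  (forall i, smooth_section F (V i)) ->
  smooth_section F (fun p => \sum_(i <- r) V i p).
Proof.
move=> sV; elim: r => [|i r IHr].
  have -> : (fun p => \sum_(i <- [::]) V i p) = fun=> 0 :> 'rV[R]_n.
    by apply/funext => p; rewrite big_nil.
  exact: smooth_section0.
have -> : (fun p => \sum_(j <- i :: r) V j p) =
    fun p => V i p + \sum_(j <- r) V j p.
  by apply/funext => p; rewrite big_cons.
exact: smooth_sectionD.
Qed.

Lemma smooth_section_comp Z : vfield Z -> smooth_section F (Z \o F).
Proof.
move=> sZ j; have oj := open_preimage _ (chart_dom_open j).
have := sZ j; rewrite !setTI => /(smooth_coordP _ _ (chart_dom_open j)) sZj.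
apply/smooth_coordP => // k.
exact: (smooth_comp F _ (fun q => tcoord j q (Z q) 0 k)) (chart_dom_open j) (sZj k).
Qed.

Lemma smooth_tmap Y : vfield Y -> smooth_section F (fun p => tmap F p (Y p)).
Proof.
move=> sY j; have oj := open_preimage _ (chart_dom_open j).
rewrite setTI => i; have oij := open_chart_image _ i oj.
have sFj := sF.2 j i.
(* The Jacobian of [F] in the charts [i] and [j], applied to the coordinates of [Y], written as a
   sum of partial derivatives. *)
pose G x : 'rV[R]_n := \sum_k tcoord i (chart_inv i x) (Y (chart_inv i x)) 0 k *:
   'D_(delta_mx 0 k) (chart j \o F \o chart_inv i) x.
move=> l; apply: (Ck_eq l _ G) => //.
  move=> _ [p [ip jp] <-]; rewrite /G /= chartK// (tcoord_tmap F sF i)//.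
  rewrite [X in _ = 'd _ _ X]row_sum_delta linear_sum/=.
  apply: eq_bigr => k _; rewrite linearZ/= deriveE//.
  exact: smooth_map_diff.
apply: Ck_sum => // k; apply: Ck_rV => // s.
apply: (Ck_eq l _ (fun x => tcoord i (chart_inv i x) (Y (chart_inv i x)) 0 k *
   ('D_(delta_mx 0 k) (chart j \o F \o chart_inv i) x) 0 s : R^o)) => //.
  by move=> x _; rewrite mxE.
apply: CkM => //.
  apply: (Ck_coord l _ (fun x => tcoord i (chart_inv i x) (Y (chart_inv i x)))) => //.
  apply: Ck_sub (sY i i l); apply: image_subset => p [ip _].
  by split.
apply: (Ck_coord l _ (fun x => 'D_(delta_mx 0 k) (chart j \o F \o chart_inv i) x)) => //.
exact: Cinfty_derive.
Qed.

End Sections.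

Section Extensions.
Context {R : realType}.

Lemma vfield_tvec_extension {n} {N : smoothManifold R n} (j : chart_index N)
    (phi : N -> R) (K : set N) w : smooth_fun phi -> closed K ->
  K `<=` chart_dom j -> (forall q, ~ K q -> phi q = 0) ->
  vfield (fun q => phi q *: tvec j q w).
Proof.
move=> sphi cK Kj phi0.
apply: (smooth_section_extension _ (smooth_map_id N) (chart_dom j) phi K) => //.
  exact: chart_dom_open.
exact: smooth_tvec.
Qed.

(** Supplies the ambient field through a prescribed vector that the defining formula of
    [pullback_connection] asks for. *)
Lemma vector_extension {n} {N : smoothManifold R n} (q : N) w : exists2 Z, vfield Z & Z q = w.
Proof.
pose j := idx q; have jq : chart_dom j q := idx_dom q.
have [phi [K [sphi phi1 cK KU phi0]]] := bump _ _ (chart_dom_open j) jq.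
exists (fun q' => phi q' *: tvec j q' (tcoord j q w)); last first.
  by rewrite phi1 scale1r tcoordK.
exact: (vfield_tvec_extension j phi K _ sphi cK KU phi0).
Qed.

(* [psi] is the square of a bump function [phi \o F]: one factor globalizes
   the coordinates of [V], the other one the coordinate frame. *)
Lemma frame_decomposition {m n} {M : smoothManifold R m}
    {N : smoothManifold R n} (F : M -> N) (p : M) : smooth_map F ->
  exists (psi : M -> R) (E : 'I_n -> N -> 'rV[R]_n),
  [/\ smooth_fun psi, psi p = 1, forall k, vfield (E k) &
    forall V, smooth_section F V -> exists h : 'I_n -> M -> R,
      (forall k, smooth_fun (h k)) /\
      forall q, psi q *: V q = \sum_k h k q *: E k (F q)].
Proof.
move=> sF; pose j := idx (F p); have jp : chart_dom j (F p) := idx_dom (F p).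
have [phi [K [sphi phi1 cK KU phi0]]] := bump _ _ (chart_dom_open j) jp.
have sphiF : smooth_fun (phi \o F).
  have := smooth_comp F setT phi sF openT sphi.
  by rewrite preimage_setT.
exists (fun q => phi (F q) * phi (F q)),
  (fun k q => phi q *: tvec j q (delta_mx 0 k)); split.
- by apply: smoothM => //; exact: openT.
- by rewrite phi1 mulr1.
- by move=> k; exact: (vfield_tvec_extension j phi K _ sphi cK KU phi0).
move=> V sV; exists (fun k q => phi (F q) * tcoord j (F q) (V q) 0 k); split.
  move=> k; apply: (smooth_extension (F @^-1` chart_dom j) setT (phi \o F) (F @^-1` K)) => //.
  - exact/(open_preimage F sF)/chart_dom_open.
  - exact: openT.
  - by apply: preimage_closed => // q _; exact: sF.1.
  - by move=> q /KU.
  - by move=> q /phi0.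
  have oj := open_preimage F sF _ (chart_dom_open j).
  by have := sV j; rewrite !setTI => /(smooth_coordP _ _ oj); exact.
move=> q; have [jq|njq] := pselect (chart_dom j (F q)); last first.
  have -> : phi (F q) = 0 by apply: phi0 => /KU.
  by rewrite mul0r scale0r big1// => k _; rewrite mul0r scale0r.
rewrite -[V q in LHS](tcoordK _ _ jq) {1}(row_sum_delta (tcoord j (F q) (V q))).
rewrite /tvec linear_sum scaler_sumr; apply: eq_bigr => k _.
rewrite linearZ/= !scalerA; congr (_ *: _); ring.
Qed.

End Extensions.

(** * Duality along a map *)

Section Directional_derivative.
Context {R : realType} {n : nat} {M : smoothManifold R n}.
Implicit Types (f g : M -> R) (p : M) (v : 'rV[R]_n).

Let diff_at f p : smooth_fun f ->
  differentiable ((f : M -> R^o) \o chart_inv_at p) (chart_at p p).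
Proof. exact: (smooth_fun_diff setT (f : M -> R^o) _ _ I (idx_dom p)). Qed.

Lemma dirDD p v f g : smooth_fun f -> smooth_fun g ->
  dirD p v (fun q => f q + g q) = dirD p v f + dirD p v g.
Proof.
move=> /(diff_at _ p) df /(diff_at _ p) dg.
exact: (congr1 (@^~ v) (diffD df dg)).
Qed.

Lemma dirDM p v f g : smooth_fun f -> smooth_fun g ->
  dirD p v (fun q => f q * g q) = f p * dirD p v g + g p * dirD p v f.
Proof.
move=> /(diff_at _ p) df /(diff_at _ p) dg.
have /(congr1 (@^~ v)) E := diffM df dg.
by apply: (etrans E); rewrite /= /chart_inv_at /chart_at chartK//; exact: idx_dom.
Qed.

Lemma dirD0 p v : dirD p v (fun=> 0 : R) = 0.
Proof. exact: (congr1 (@^~ v) (diff_cst (0 : R^o) _)). Qed.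

End Directional_derivative.

Section Metric_algebra.
Context {R : realType} {n : nat} {N : smoothManifold R n}.
Variable g : N -> 'rV[R]_n -> 'rV[R]_n -> R.
Hypothesis hg : semi_riemannian g.

Lemma metricDl p u v w : g p (u + v) w = g p u w + g p v w.
Proof. by rewrite -[u]scale1r (metric_linear hg) mul1r scale1r. Qed.

Lemma metric0l p w : g p 0 w = 0.
Proof.
have /eqP := metricDl p 0 0 w.
by rewrite addr0 -subr_eq0 opprD addNKr oppr_eq0 => /eqP.
Qed.

Lemma metricZl p a u w : g p (a *: u) w = a * g p u w.
Proof. by rewrite -[a *: u]addr0 (metric_linear hg) metric0l addr0. Qed.

Lemma metricBl p u v w : g p (u - v) w = g p u w - g p v w.
Proof. by rewrite metricDl -scaleN1r metricZl mulN1r. Qed.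

Lemma metricZr p a u w : g p w (a *: u) = a * g p w u.
Proof. by rewrite !(Defs.metric_sym hg p w) metricZl. Qed.

Lemma metric_suml p (I : Type) (r : seq I) (u : I -> 'rV[R]_n) w :
  g p (\sum_(i <- r) u i) w = \sum_(i <- r) g p (u i) w.
Proof.
by elim: r => [|i r IHr]; rewrite ?big_nil ?metric0l// !big_cons metricDl IHr.
Qed.

End Metric_algebra.

Section Duality.
Context {R : realType} {m n : nat}.
Context {M : smoothManifold R m} {N : smoothManifold R n}.
Variables (F : M -> N) (g : N -> 'rV[R]_n -> 'rV[R]_n -> R).
Hypotheses (sF : smooth_map F) (hg : semi_riemannian g).

(** [metric_smooth] covers ambient fields only, and sections along [F] need not be restrictions of
    such fields. Multiplied by [psi], both become combinations of an ambient frame; the factor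
    [psi * psi] is then divided out. *)
Lemma smooth_pairing V W : smooth_section F V -> smooth_section F W ->
  smooth_fun (fun q => g (F q) (V q) (W q)).
Proof.
move=> sV sW; apply: smooth_of_multiple => p.
have [psi [E [spsi psi1 sE decE]]] := frame_decomposition F p sF.
have [a [sa eV]] := decE V sV; have [b [sb eW]] := decE W sW.
exists (fun q => psi q * psi q); split.
- by apply: smoothM => //; exact: openT.
- by rewrite psi1 mulr1 oner_eq0.
apply: (smooth_fun_on_eq _ (fun q => \sum_k \sum_l
   a k q * (b l q * ((fun x => g x (E k x) (E l x)) \o F) q) : R^o)).
- exact: openT.
- move=> q _; rewrite -mulrA -(metricZr g hg) -(metricZl g hg) eV eW.
  rewrite (metric_suml g hg); apply: eq_bigr => k _.
  rewrite (Defs.metric_sym hg) (metric_suml g hg); apply: eq_bigr => l _.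
  by rewrite (metricZr g hg) (metricZl g hg) /= (Defs.metric_sym hg).
apply: smooth_sum; first exact: openT.
move=> k; apply: smooth_sum; first exact: openT.
move=> l; apply: smoothM; [exact: openT|exact: sa|].
apply: smoothM; [exact: openT|exact: sb|].
have := smooth_comp F setT (fun x => g x (E k x) (E l x)) sF openT.
rewrite preimage_setT; apply; exact: metric_smooth.
Qed.

Definition dual_defect
    (D D' : (M -> 'rV[R]_m) -> (M -> 'rV[R]_n) -> M -> 'rV[R]_n) X V W p : R :=
  dirD p (X p) (fun q => g (F q) (V q) (W q))
  - g (F p) (D X V p) (W p) - g (F p) (V p) (D' X W p).

(** Exchanging the two connections exchanges the two slots, so tensoriality is needed in the first
    slot only. *)
Lemma dual_defect_sym D D' X V W p :
  dual_defect D D' X V W p = dual_defect D' D X W V p.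
Proof.
rewrite /dual_defect (Defs.metric_sym hg _ (D X V p)).
rewrite (Defs.metric_sym hg _ (V p)) addrAC.
by under eq_fun do rewrite (Defs.metric_sym hg).
Qed.

Section Tensoriality.
Variables D D' : (M -> 'rV[R]_m) -> (M -> 'rV[R]_n) -> M -> 'rV[R]_n.
Hypothesis cD : connection_along F D.
Variables (X : M -> 'rV[R]_m) (W : M -> 'rV[R]_n) (p : M).
Hypotheses (sX : vfield X) (sW : smooth_section F W).

Lemma dual_defectD V V' : smooth_section F V -> smooth_section F V' ->
  dual_defect D D' X (fun q => V q + V' q) W p =
  dual_defect D D' X V W p + dual_defect D D' X V' W p.
Proof.
move=> sV sV'; rewrite /dual_defect (conn_additive cD)// !(metricDl g hg).
rewrite -[dirD _ _ _](congr1 (dirD p (X p)) (funext (fun q =>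
   esym (metricDl g hg (F q) (V q) (V' q) (W q))))).
have arith (a b c d e f : R) : a + b - (c + d) - (e + f) =
  (a - c - e) + (b - d - f) by ring.
by rewrite dirDD; [exact: arith|exact: smooth_pairing|exact: smooth_pairing].
Qed.

Lemma dual_defectZ h V : smooth_fun h -> smooth_section F V ->
  dual_defect D D' X (fun q => h q *: V q) W p = h p * dual_defect D D' X V W p.
Proof.
move=> sh sV; rewrite /dual_defect (conn_leibniz cD)//.
rewrite !(metricDl g hg) !(metricZl g hg).
rewrite -[dirD _ _ _](congr1 (dirD p (X p)) (funext (fun q =>
   esym (metricZl g hg (F q) (h q) (V q) (W q))))).
have arith (a b c d e f : R) : a * b + c * d - (d * c + a * e) - a * f =
  a * (b - e - f) by ring.
by rewrite dirDM; [exact: arith|exact: sh|exact: smooth_pairing].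
Qed.

Lemma dual_defect_sum (I : Type) (r : seq I) (V : I -> M -> 'rV[R]_n) :
  (forall i, smooth_section F (V i)) ->
  dual_defect D D' X (fun q => \sum_(i <- r) V i q) W p =
  \sum_(i <- r) dual_defect D D' X (V i) W p.
Proof.
move=> sV; elim: r => [|i r IHr].
  rewrite big_nil.
  (* Writing the zero section as [0 *: 0] makes its defect vanish by homogeneity. *)
  have -> : (fun q => \sum_(i <- [::]) V i q) = fun q => 0 *: (0 : 'rV[R]_n).
    by apply/funext => q; rewrite big_nil scale0r.
  rewrite dual_defectZ ?mul0r//; [exact: smooth_cst|exact: smooth_section0].
rewrite big_cons -IHr -dual_defectD//; last exact: smooth_section_sum.
by congr dual_defect; apply/funext => q; rewrite big_cons.
Qed.

(** As [psi p = 1], the defects of [V] and of [psi *: V] agree at [p], and the latter expands over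
    the whole manifold in restricted ambient fields. *)
Lemma dual_defect_frame :
  (forall Z, vfield Z -> dual_defect D D' X (Z \o F) W p = 0) ->
  forall V, smooth_section F V -> dual_defect D D' X V W p = 0.
Proof.
move=> h0 V sV; have [psi [E [spsi psi1 sE decE]]] := frame_decomposition F p sF.
have [a [sa eV]] := decE V sV.
have sEF k : smooth_section F (E k \o F) by exact: smooth_section_comp.
rewrite -[LHS]mul1r -psi1 -dual_defectZ// (funext eV) dual_defect_sum.
  by rewrite big1// => k _; rewrite (dual_defectZ (a k) (E k \o F))// h0 ?mulr0.
by move=> k; apply: (smooth_sectionZ F sF (a k) (E k \o F)).
Qed.

End Tensoriality.

Lemma pullback_duality nabla nabla' D D' X V W p :
  (forall X Y Z, vfield X -> vfield Y -> vfield Z -> forall q,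
     dirD q (X q) (fun q => g q (Y q) (Z q)) =
     g q (nabla X Y q) (Z q) + g q (Y q) (nabla' X Z q)) ->
  pullback_connection F nabla D -> pullback_connection F nabla' D' ->
  vfield X -> smooth_section F V -> smooth_section F W ->
  dual_defect D D' X V W p = 0.
Proof.
move=> hdual [cD hD] [cD' hD'] sX sV sW.
apply: (dual_defect_frame _ _ cD _ _ _ sX sW) sV => Z sZ.
have sZF : smooth_section F (Z \o F) by exact: smooth_section_comp.
rewrite dual_defect_sym.
apply: (dual_defect_frame _ _ cD' _ _ _ sX sZF) sW => Y sY.
(* Both slots now hold restrictions of ambient fields. The pullback formula sees [X] only through
   its image at [F p], and any ambient extension of that vector brings in the ambient duality. *)
have [X' sX' eX'] := vector_extension (F p) (tmap F p (X p)).
rewrite dual_defect_sym /dual_defect (hD _ _ _ _ sX sX')// (hD' _ _ _ _ sX sX')//.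
rewrite -[dirD _ _ _]/(dirD p (X p) ((fun q => g q (Z q) (Y q)) \o F)).
rewrite dirD_comp//; last exact: metric_smooth.
by rewrite -eX' hdual// addrAC addrK subrr.
Qed.

End Duality.

(** * Lightlike hypersurfaces *)

Section Lightlike_hypersurface.
Context {R : realType} {n : nat}.
Context {Mb : smoothManifold R n.+2} {M : smoothManifold R n.+1}.
Variables (gb : Mb -> 'rV[R]_n.+2 -> 'rV[R]_n.+2 -> R) (F : M -> Mb).
Variable SM : M -> set 'rV[R]_n.+1.
Hypotheses (hg : semi_riemannian gb) (hlight : lightlike_hypersurface gb F).
Hypothesis hscreen : screen_distribution gb F SM.

Let sF : smooth_map F := hlight.1.1.
Let tmap_inj p : injective (tmap F p) := hlight.1.2 p.
Let sM := smooth_map_id M.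
Local Notation g := (induced_metric gb F).

Lemma induced_sym p u v : g p u v = g p v u.
Proof. exact: (Defs.metric_sym hg). Qed.

Lemma inducedDl p u v w : g p (u + v) w = g p u w + g p v w.
Proof. by rewrite /induced_metric /tmap linearD (metricDl gb hg). Qed.

Lemma inducedZl p a u w : g p (a *: u) w = a * g p u w.
Proof. by rewrite /induced_metric /tmap linearZ (metricZl gb hg). Qed.

Lemma induced0l p w : g p 0 w = 0.
Proof. by rewrite -(scale0r 0) inducedZl mul0r. Qed.

Lemma inducedBl p u v w : g p (u - v) w = g p u w - g p v w.
Proof. by rewrite inducedDl -scaleN1r inducedZl mulN1r. Qed.

Lemma inducedDr p u v w : g p w (u + v) = g p w u + g p w v.
Proof. by rewrite !(induced_sym p w) inducedDl. Qed.

Lemma induced_suml p (I : Type) (r : seq I) (u : I -> 'rV[R]_n.+1) w :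
  g p (\sum_(i <- r) u i) w = \sum_(i <- r) g p (u i) w.
Proof.
by elim: r => [|i r IHr]; rewrite ?big_nil ?induced0l// !big_cons inducedDl IHr.
Qed.

Lemma smooth_induced Y Z : vfield Y -> vfield Z ->
  smooth_fun (fun q => g q (Y q) (Z q)).
Proof.
by move=> sY sZ; apply: (smooth_pairing F gb sF hg); exact: smooth_tmap.
Qed.

Lemma screen_matrix p : exists A : 'M[R]_(n, n.+1),
  forall v, SM p v <-> (v <= A)%MS.
Proof.
have [dS _ _ _] := hscreen; have [U [E [_ Up _ ES]]] := dS p.
by exists (\matrix_(k < n) E k p); have [_] := ES p Up.
Qed.

Lemma screenD p u v : SM p u -> SM p v -> SM p (u + v).
Proof. by have [A SA] := screen_matrix p; rewrite !SA; exact: addmx_sub. Qed.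

Lemma screenZ p a u : SM p u -> SM p (a *: u).
Proof. by have [A SA] := screen_matrix p; rewrite !SA; exact: scalemx_sub. Qed.

Lemma screen0 p : SM p 0.
Proof. by have [A SA] := screen_matrix p; rewrite !SA; exact: sub0mx. Qed.

Lemma screen_sum p (I : Type) (r : seq I) (u : I -> 'rV[R]_n.+1) :
  (forall i, SM p (u i)) -> SM p (\sum_(i <- r) u i).
Proof.
move=> Su; elim: r => [|i r IHr]; first by rewrite big_nil; exact: screen0.
by rewrite big_cons; exact: screenD.
Qed.

(* With L the matrix of w, v |-> gb(dF w, v), the functional gb(dF x, _) is not
   in the span of the functionals gb(dF w, _), w in the screen, so some nu0
   kills the latter and not the former; then correct nu0 along dF x to make it
   null. *)
Lemma transversal_exists p x : x != 0 -> radical gb F p x ->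
  exists nu, Defs.transversal gb F SM p x nu.
Proof.
move=> x0 rx; have [A SA] := screen_matrix p.
have [_ _ _ radS] := hscreen.
pose L : 'M[R]_(n.+1, n.+2) :=
  \matrix_(i, j) gb (F p) (tmap F p (delta_mx 0 i)) (delta_mx 0 j).
have LE w v : (w *m L *m v^T) 0 0 = gb (F p) (tmap F p w) v.
  rewrite [in RHS](row_sum_delta w) /tmap linear_sum (metric_suml gb hg).
  rewrite mxE; under eq_bigr do rewrite !mxE mulr_suml.
  rewrite exchange_big/=; apply: eq_bigr => i _.
  rewrite linearZ/= (metricZl gb hg) (Defs.metric_sym hg) [in RHS](row_sum_delta v).
  rewrite (metric_suml gb hg) mulr_sumr; apply: eq_bigr => j _.
  rewrite mxE (metricZl gb hg) (Defs.metric_sym hg); ring.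
(* Otherwise [x] and a screen vector [d *m A] would define the same functional; nondegeneracy of
   [gb] and injectivity of [tmap F p] identify them, putting the nonzero radical vector [x] in the
   screen. *)
have nsub : ~~ (x *m L <= A *m L)%MS.
  apply/negP => /submxP[d dE]; move/eqP: x0; apply.
  apply: radS (rx) _; apply/SA; suff -> : x = d *m A by exact: submxMl.
  apply/eqP; rewrite -subr_eq0; apply/eqP/(tmap_inj p).
  rewrite [RHS]linear0; apply: (@metric_nondeg _ _ _ _ hg (F p)) => v.
  by rewrite -LE mulmxBl dE mulmxA subrr mul0mx mxE.
rewrite submxE in nsub; have /rV0Pn[j cj] := nsub.
set c := (_ *m _) 0 j in cj.
(* The columns of the cokernel matrix annihilate the row space of [A *m L]; column [j] is one that
   detects [x *m L], and [c^-1] normalizes the pairing with [x] to 1. *)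
pose nu0 := c^-1 *: (col j (cokermx (A *m L)))^T.
have nu0E w : gb (F p) nu0 (tmap F p w) =
    c^-1 * (w *m L *m cokermx (A *m L)) 0 j.
  rewrite (Defs.metric_sym hg) -LE /nu0 linearZ/= trmxK -scalemxAr [LHS]mxE.
  by rewrite colE mulmxA -colE [in LHS]mxE.
clearbody nu0.
have nu0x : gb (F p) nu0 (tmap F p x) = 1 by rewrite nu0E mulVf.
have nu0S w : SM p w -> gb (F p) nu0 (tmap F p w) = 0.
  move=> /SA/submxP[d ->]; rewrite nu0E -!mulmxA (mulmxA A) mulmx_coker mulmx0.
  by rewrite mxE mulr0.
(* Subtracting [a] times the null vector [tmap F p x], which pairs to 1 with [nu0], lowers the
   square of [nu0] by [2 a]; hence the half. Pairings with tangent vectors do not change, since [x]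
   is radical. *)
exists (nu0 - (gb (F p) nu0 nu0 / 2) *: tmap F p x); split.
- rewrite (metricBl gb hg) (metricZl gb hg) (Defs.metric_sym hg _ nu0).
  rewrite (Defs.metric_sym hg _ (tmap F p x)) !(metricBl gb hg) !(metricZl gb hg).
  rewrite (Defs.metric_sym hg _ (tmap F p x)) nu0x.
  have -> : gb (F p) (tmap F p x) (tmap F p x) = 0 by exact: rx.
  by field.
- by rewrite (metricBl gb hg) (metricZl gb hg) nu0x [X in _ * X]rx mulr0 subr0.
- move=> w Sw; rewrite (metricBl gb hg) (metricZl gb hg) nu0S//.
  by rewrite [X in _ * X]rx mulr0 subr0.
Qed.

Lemma transversal_frame p : exists x nu,
  [/\ x != 0, radical gb F p x & Defs.transversal gb F SM p x nu].
Proof.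
have [x [x0 rx]] := hlight.2 p; have [nu tnu] := transversal_exists p x x0 rx.
by exists x, nu.
Qed.

(** A local frame cut off by [phi] has global smooth members and stays a frame wherever [phi] is
    nonzero. The coefficients [c] are pointwise; smooth ones come later from the Gram matrix. *)
Lemma screen_frame p : exists (phi : M -> R) (E : 'I_n -> M -> 'rV[R]_n.+1),
  [/\ smooth_fun phi, phi p = 1, forall k, section_of SM (E k) &
   forall q, phi q != 0 ->
     (forall v, SM q v -> exists c : 'I_n -> R, v = \sum_k c k *: E k q) /\
     (forall c : 'rV[R]_n, \sum_k c 0 k *: E k q = 0 -> c = 0)].
Proof.
have [dS _ _ _] := hscreen; have [U [E [oU Up sE ES]]] := dS p.
have [phi [K [sphi phi1 cK KU phi0]]] := bump _ _ oU Up.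
exists phi, (fun k q => phi q *: E k q); split=> //.
- move=> k; split.
    exact: (smooth_section_extension _ sM U phi K (E k) oU sphi cK KU phi0).
  move=> q; have [Uq|nUq] := pselect (U q).
    apply: screenZ; apply/((ES q Uq).2 (E k q)).
    by rewrite -[E k q](rowK (fun k => E k q)); exact: row_sub.
  rewrite phi0 ?scale0r; first exact: screen0.
  by move=> /KU.
move=> q phiq; have [Uq|nUq] := pselect (U q); last first.
  by move/eqP: phiq; case; apply: phi0 => /KU.
have [freeE SE] := ES q Uq; split=> [v /SE/submxP[d ->]|c cE].
  exists (fun k => d 0 k / phi q); rewrite mulmx_sum_row; apply: eq_bigr => k _.
  by rewrite rowK scalerA divfK.
apply/eqP; rewrite -(mulmx_free_eq0 _ freeE) mulmx_sum_row; apply/eqP.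
apply: (scalerI phiq); rewrite scaler0 -[RHS]cE scaler_sumr.
by apply: eq_bigr => k _; rewrite rowK !scalerA mulrC.
Qed.

Lemma section_of_sum (I : Type) (r : seq I) (a : I -> M -> R)
    (V : I -> M -> 'rV[R]_n.+1) :
  (forall i, smooth_fun (a i)) -> (forall i, section_of SM (V i)) ->
  section_of SM (fun q => \sum_(i <- r) a i q *: V i q).
Proof.
move=> sa SV; split=> [|p]; last first.
  by apply: screen_sum => i; apply: screenZ; exact: (SV i).2.
apply: (smooth_section_sum _ sM I r (fun i q => a i q *: V i q)) => i.
exact: (smooth_sectionZ _ sM (a i) (V i) (sa i) (SV i).1).
Qed.

Lemma screen_extension p v : SM p v ->
  exists2 V, section_of SM V & V p = v.
Proof.
have [phi [E [_ phi1 SE spanE]]] := screen_frame p.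
have phip : phi p != 0 by rewrite phi1 oner_eq0.
move=> /(spanE p phip).1[c ->]; exists (fun q => \sum_k c k *: E k q) => //.
by apply: (section_of_sum _ _ (fun k => fun=> c k)) => // k; exact: smooth_cst.
Qed.

(* Cramer's rule for the Gram matrix of a screen frame avoids dividing by its
   determinant. *)
Lemma screen_radical_decomposition p : exists h : M -> R,
  [/\ smooth_fun h, h p != 0 & forall Y, vfield Y ->
    exists Ys Yr, [/\ section_of SM Ys, section_of (radical gb F) Yr &
      forall q, h q *: Y q = Ys q + Yr q]].
Proof.
have [phi [E [sphi phi1 SE spanE]]] := screen_frame p.
have [_ ndS TRS _] := hscreen.
pose G q : 'M[R]_n := \matrix_(k, l) g q (E k q) (E l q).
have sG k l : smooth_fun (fun q => G q k l).
  apply: (smooth_fun_on_eq _ (fun q => g q (E k q) (E l q) : R^o)).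
  - exact: openT.
  - by move=> q _; rewrite mxE.
  - by apply: smooth_induced; [exact: (SE k).1|exact: (SE l).1].
have sdet : smooth_fun (fun q => \det (G q)).
  by apply: smooth_det; [exact: openT|exact: sG].
exists (fun q => phi q * \det (G q)); split.
- by apply: smoothM => //; exact: openT.
- have phip : phi p != 0 by rewrite phi1 oner_eq0.
  (* A kernel vector of the Gram matrix gives the coefficients of a screen vector orthogonal to the
     screen, which is 0 by nondegeneracy. *)
  rewrite mulf_neq0//; apply/negP => /det0P[v v0 vG].
  have [span free] := spanE p phip; move/eqP: v0; apply; apply: free.
  apply: ndS => [|w /span[c ->]].
    by apply: screen_sum => k; apply: screenZ; exact: (SE k).2.
  rewrite induced_sym induced_suml big1// => l _.
  rewrite inducedZl induced_sym induced_suml.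
  have /matrixP/(_ 0 l) := vG; rewrite !mxE => vGl.
  rewrite -[RHS](mulr0 (c l)) -[in RHS]vGl; congr (_ * _).
  by apply: eq_bigr => k _; rewrite inducedZl mxE.
move=> Y sY.
pose a k q := phi q * \sum_l g q (Y q) (E l q) * \adj (G q) l k.
pose Ys q := \sum_k a k q *: E k q.
have sa k : smooth_fun (a k).
  apply: smoothM => //; first exact: openT.
  apply: smooth_sum; first exact: openT.
  move=> l; apply: smoothM; first exact: openT.
    by apply: smooth_induced => //; exact: (SE l).1.
  by apply: smooth_adj; [exact: openT|exact: sG].
have SYs : section_of SM Ys by exact: section_of_sum.
have sh : smooth_fun (fun q => phi q * \det (G q)).
  by apply: smoothM => //; exact: openT.
exists Ys, (fun q => (phi q * \det (G q)) *: Y q - Ys q); split=> //; last first.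
  by move=> q; rewrite addrC subrK.
split.
  have -> : (fun q => (phi q * \det (G q)) *: Y q - Ys q) =
      fun q => (phi q * \det (G q)) *: Y q + (-1) *: Ys q.
    by apply/funext => q; rewrite scaleN1r.
  apply: (smooth_sectionD _ sM).
    exact: (smooth_sectionZ _ sM (fun q => phi q * \det (G q)) Y).
  apply: (smooth_sectionZ _ sM (fun=> -1) Ys _ SYs.1); exact: smooth_cst.
(* Where [phi] vanishes the frame need not span the screen; this is why [phi] is a factor both of
   [h] and of the coefficients [a k], making the radical part 0 there. *)
move=> q; have [phiq|phiq] := eqVneq (phi q) 0.
  have -> : Ys q = 0.
    by rewrite /Ys big1// => k _; rewrite /a phiq mul0r scale0r.
  by rewrite phiq mul0r scale0r subr0 => v; rewrite induced0l.
have YE m : g q ((phi q * \det (G q)) *: Y q - Ys q) (E m q) = 0.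
  rewrite inducedBl inducedZl induced_suml.
  have -> : \sum_k g q (a k q *: E k q) (E m q) =
     phi q * \sum_l g q (Y q) (E l q) * (\adj (G q) *m G q) l m.
    rewrite mulr_sumr.
    under eq_bigr do rewrite inducedZl /a -mulrA mulr_suml mulr_sumr.
    rewrite exchange_big/=; apply: eq_bigr => l _.
    rewrite mxE !mulr_sumr; apply: eq_bigr => k _.
    by rewrite [G q k m]mxE !mulrA.
  rewrite mul_adj_mx -mulrA (bigD1 m)//= big1 => [|l lm]; last first.
    by rewrite !mxE (negPf lm) mulr0n mulr0.
  by rewrite !mxE eqxx mulr1n addr0 [_ * \det _]mulrC subrr.
(* The remainder is orthogonal to the frame by [YE], hence to the screen, and to the radical by
   definition; together these span the tangent space. *)
move=> v; have [r [s [rr Ss ->]]] := TRS q v.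
rewrite inducedDr (induced_sym q _ r) rr add0r.
have [c ->] := (spanE q phiq).1 s Ss.
rewrite induced_sym induced_suml big1// => k _.
by rewrite inducedZl induced_sym YE mulr0.
Qed.

(** * Calculus of the induced connections *)

Section Induced_connection.
Variable D : (M -> 'rV[R]_n.+1) -> (M -> 'rV[R]_n.+2) -> M -> 'rV[R]_n.+2.
Variable nabla : (M -> 'rV[R]_n.+1) -> (M -> 'rV[R]_n.+1) -> M -> 'rV[R]_n.+1.
Hypotheses (cD : connection_along F D)
  (hnabla : induced_connection gb F SM D nabla).

Lemma induced_connection_screen X Y p w : vfield X -> vfield Y -> SM p w ->
  gb (F p) (D X (fun q => tmap F q (Y q)) p) (tmap F p w) = g p (nabla X Y p) w.
Proof.
move=> sX sY Sw; have [_ hXY] := hnabla X Y sX sY.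
have [x [nu [x0 rx tnu]]] := transversal_frame p.
have [b ->] := hXY p x nu x0 rx tnu; have [_ _ nuS] := tnu.
by rewrite (metricDl gb hg) (metricZl gb hg) nuS// mulr0 addr0.
Qed.

(** Pairing with [tmap F p x] gives 0 on tangent vectors and 1 on [nu], so the tangential part in
    the Gauss formula is unique. *)
Lemma tangent_transversal p x nu u b : radical gb F p x ->
  Defs.transversal gb F SM p x nu -> tmap F p u = b *: nu -> u = 0.
Proof.
move=> rx [_ nux _] e.
have b0 : b = 0.
  rewrite -[b]mulr1 -nux -(metricZl gb hg) -e.
  by have := rx u; rewrite induced_sym.
by apply: (tmap_inj p); rewrite e b0 scale0r [RHS]linear0.
Qed.

(** The Gauss formulas of the three fields, taken with the same [nu], make the image of the
    difference of the two sides a multiple of [nu]. *)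
Lemma induced_connectionD X Y Y' p : vfield X -> vfield Y -> vfield Y' ->
  nabla X (fun q => Y q + Y' q) p = nabla X Y p + nabla X Y' p.
Proof.
move=> sX sY sY'; have [x [nu [x0 rx tnu]]] := transversal_frame p.
have sYY' : vfield (fun q => Y q + Y' q) by exact: (smooth_sectionD _ sM).
have [b e] := (hnabla X _ sX sYY').2 p x nu x0 rx tnu.
have [b1 e1] := (hnabla X _ sX sY).2 p x nu x0 rx tnu.
have [b2 e2] := (hnabla X _ sX sY').2 p x nu x0 rx tnu.
apply/eqP; rewrite -subr_eq0; apply/eqP.
apply: (tangent_transversal p x nu _ (b1 + b2 - b) rx tnu).
have : D X (fun q => tmap F q (Y q + Y' q)) p =
    D X (fun q => tmap F q (Y q)) p + D X (fun q => tmap F q (Y' q)) p.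
  rewrite -(conn_additive cD) ?smooth_tmap//; [|exact: smooth_tmap..].
  by congr (D X _ p); apply/funext => q; rewrite [LHS]linearD.
rewrite e e1 e2 => E.
have -> : tmap F p (nabla X (fun q => Y q + Y' q) p - (nabla X Y p + nabla X Y' p)) =
    tmap F p (nabla X (fun q => Y q + Y' q) p) - (tmap F p (nabla X Y p) + tmap F p (nabla X Y' p)).
  by rewrite /tmap linearB linearD.
rewrite -[tmap F p (nabla X (fun q => Y q + Y' q) p)](addrK (b *: nu)) E.
apply/eqP; rewrite subr_eq scalerBl scalerDl addrACA.
by rewrite [X in _ == X]addrC [X in _ == X]addrA.
Qed.

Lemma induced_connectionZ X (h : M -> R) Y p : smooth_fun h -> vfield X ->
  vfield Y -> nabla X (fun q => h q *: Y q) p =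
    dirD p (X p) h *: Y p + h p *: nabla X Y p.
Proof.
move=> sh sX sY; have [x [nu [x0 rx tnu]]] := transversal_frame p.
have shY : vfield (fun q => h q *: Y q) by exact: (smooth_sectionZ _ sM).
have [b e] := (hnabla X _ sX shY).2 p x nu x0 rx tnu.
have [b1 e1] := (hnabla X _ sX sY).2 p x nu x0 rx tnu.
apply/eqP; rewrite -subr_eq0; apply/eqP.
apply: (tangent_transversal p x nu _ (h p * b1 - b) rx tnu).
have : D X (fun q => tmap F q (h q *: Y q)) p =
    dirD p (X p) h *: tmap F p (Y p) + h p *: D X (fun q => tmap F q (Y q)) p.
  rewrite -(conn_leibniz cD)//; last exact: smooth_tmap.
  by congr (D X _ p); apply/funext => q; rewrite [LHS]linearZ.
rewrite e e1 => E.
have -> : tmap F p (nabla X (fun q => h q *: Y q) p - (dirD p (X p) h *: Y p + h p *: nabla X Y p)) =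
    tmap F p (nabla X (fun q => h q *: Y q) p) - (dirD p (X p) h *: tmap F p (Y p) + h p *: tmap F p (nabla X Y p)).
  by rewrite /tmap linearB linearD !linearZ.
rewrite -[tmap F p (nabla X (fun q => h q *: Y q) p)](addrK (b *: nu)) E.
apply/eqP; rewrite subr_eq scalerBl -scalerA [h p *: (_ + _)]scalerDr addrA.
by rewrite [X in _ == X]addrC [X in _ == X]addrA.
Qed.

Lemma cov_metric_sym X Y Z p : 
  cov_metric g nabla X Y Z p = cov_metric g nabla X Z Y p.
Proof.
rewrite /cov_metric (induced_sym p (nabla X Y p)) (induced_sym p (Y p)) addrAC.
by under eq_fun do rewrite induced_sym.
Qed.

Lemma cov_metricD X Y Y' Z p : vfield X -> vfield Y -> vfield Y' -> vfield Z ->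
  cov_metric g nabla X (fun q => Y q + Y' q) Z p =
  cov_metric g nabla X Y Z p + cov_metric g nabla X Y' Z p.
Proof.
move=> sX sY sY' sZ; rewrite /cov_metric induced_connectionD// !inducedDl.
under eq_fun do rewrite inducedDl.
have arith (a b c d e f : R) : a + b - (c + d) - (e + f) =
  (a - c - e) + (b - d - f) by ring.
by rewrite dirDD; [exact: arith|exact: smooth_induced|exact: smooth_induced].
Qed.

Lemma cov_metricZ X (h : M -> R) Y Z p : smooth_fun h -> vfield X ->
  vfield Y -> vfield Z ->
  cov_metric g nabla X (fun q => h q *: Y q) Z p =
  h p * cov_metric g nabla X Y Z p.
Proof.
move=> sh sX sY sZ; rewrite /cov_metric induced_connectionZ// inducedDl !inducedZl.
under eq_fun do rewrite inducedZl.
have arith (a b c d e f : R) : a * b + c * d - (d * c + a * e) - a * f =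
  a * (b - e - f) by ring.
by rewrite dirDM; [exact: arith|exact: sh|exact: smooth_induced].
Qed.

Lemma cov_metric_radical X Y Z p : parallel (radical gb F) nabla ->
  vfield X -> section_of (radical gb F) Y -> cov_metric g nabla X Y Z p = 0.
Proof.
move=> hrad sX RY; have [_ RnY] := hrad X Y sX RY.
rewrite /cov_metric RnY RY.2; under eq_fun do rewrite RY.2.
by rewrite dirD0 !subr0.
Qed.

Lemma metric_connection_of_screen : parallel (radical gb F) nabla ->
  (forall X Y Z, vfield X -> section_of SM Y -> section_of SM Z -> forall p,
     cov_metric g nabla X Y Z p = 0) -> metric_connection g nabla.
Proof.
move=> hrad hSS.
(* One slot is decomposed at a time: here the first, with a screen field in the second; afterwards
   [cov_metric_sym] reduces the general case to this one. *)
have hS X Y Z p : vfield X -> section_of SM Y -> vfield Z ->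
    cov_metric g nabla X Z Y p = 0.
  move=> sX SY sZ; have [h [sh hp dec]] := screen_radical_decomposition p.
  have [Zs [Zr [SZs RZr eZ]]] := dec Z sZ.
  apply: (mulfI hp); rewrite mulr0 -cov_metricZ//; last exact: SY.1.
  rewrite (funext eZ) cov_metricD//; [|exact: SZs.1|exact: RZr.1|exact: SY.1].
  by rewrite hSS// cov_metric_radical// addr0.
move=> X Y Z sX sY sZ p; have [h [sh hp dec]] := screen_radical_decomposition p.
have [Ys [Yr [SYs RYr eY]]] := dec Y sY.
apply: (mulfI hp); rewrite mulr0 -cov_metricZ//.
rewrite (funext eY) cov_metricD//; [|exact: SYs.1|exact: RYr.1].
by rewrite cov_metric_sym hS// cov_metric_radical// addr0.
Qed.

(** The two sides differ by a multiple of a radical vector; parallelism puts the difference in the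
    screen as well, and the two distributions meet in 0. *)
Lemma screen_connection_parallel nablaS X W p :
  screen_connection gb F SM nabla nablaS -> parallel SM nabla ->
  vfield X -> section_of SM W -> nabla X W p = nablaS X W p.
Proof.
move=> hnS hS sX SW; have [_ _ _ radS] := hscreen.
have [[_ SnS] /(_ p) ex] := hnS X W sX SW; have [_ Sn] := hS X W sX SW.
have [x [x0 rx]] := hlight.2 p; have [c e] := ex x x0 rx.
suff c0 : c *: x = 0 by rewrite e c0 addr0.
apply: (radS p) => [v|]; first by rewrite inducedZl rx mulr0.
have -> : c *: x = nabla X W p + (-1) *: nablaS X W p.
  by rewrite e scaleN1r addrC addKr.
by apply: screenD => //; exact: screenZ.
Qed.

End Induced_connection.

(** * Duality of the induced connections on the screen *)

Section Dual_connections.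
Variables D Ds : (M -> 'rV[R]_n.+1) -> (M -> 'rV[R]_n.+2) -> M -> 'rV[R]_n.+2.
Variables nabla nablas :
  (M -> 'rV[R]_n.+1) -> (M -> 'rV[R]_n.+1) -> M -> 'rV[R]_n.+1.
Hypothesis cD : connection_along F D.
Hypothesis dualD : forall X V W p, vfield X -> smooth_section F V ->
  smooth_section F W -> dual_defect F gb D Ds X V W p = 0.
Hypotheses (hnabla : induced_connection gb F SM D nabla)
  (hnablas : induced_connection gb F SM Ds nablas).

Lemma screen_duality X V W p : vfield X -> section_of SM V ->
  section_of SM W -> dirD p (X p) (fun q => g q (V q) (W q)) =
    g p (nabla X V p) (W p) + g p (V p) (nablas X W p).
Proof.
move=> sX SV SW.
have := dualD X _ _ p sX (smooth_tmap F sF V SV.1) (smooth_tmap F sF W SW.1).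
rewrite /dual_defect (induced_connection_screen D nabla)//; [|exact: SV.1|exact: SW.2].
rewrite (Defs.metric_sym hg) (induced_connection_screen Ds nablas)//;
  [|exact: SW.1|exact: SV.2].
by move=> /eqP; rewrite -addrA -opprD subr_eq0 => /eqP ->; rewrite (induced_sym p (V p)).
Qed.

Lemma metric_screen_eq : parallel SM nabla -> parallel SM nablas ->
  metric_connection g nabla ->
  forall X W, vfield X -> section_of SM W -> forall p,
    nabla X W p = nablas X W p.
Proof.
move=> hS hSs hm X W sX SW p; have [_ ndS _ _] := hscreen.
have [_ SnW] := hS X W sX SW; have [_ SnsW] := hSs X W sX SW.
apply/eqP; rewrite -subr_eq0; apply/eqP; apply: (ndS p).
  by rewrite -scaleN1r; apply: screenD => //; exact: screenZ.
(* Nondegeneracy tests single vectors while connections act on fields, so [v] is extended. With [V]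
   in the first slot, duality cancels the term in [nabla X V] and leaves the equality of the
   pairings of [V] with [nabla X W] and [nablas X W]. *)
move=> v Sv; have [V SV <-] := screen_extension p v Sv.
have := hm X V W sX SV.1 SW.1 p.
rewrite /cov_metric (screen_duality X V W)// [X in X - _ - _]addrC addrK => /eqP.
by rewrite inducedBl !(induced_sym p _ (V p)) subr_eq0 => /eqP ->; rewrite subrr.
Qed.

Lemma screen_eq_metric : parallel (radical gb F) nabla ->
  (forall X W, vfield X -> section_of SM W -> forall p,
    nabla X W p = nablas X W p) -> metric_connection g nabla.
Proof.
move=> hrad heq; apply: (metric_connection_of_screen D) => // X Y Z sX SY SZ p.
by rewrite /cov_metric screen_duality// !heq// -addrA -opprD subrr.
Qed.

End Dual_connections.

End Lightlike_hypersurface.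

Theorem theorem3p7 (R : realType) (n : nat)
  (Mb : smoothManifold R n.+2) (M : smoothManifold R n.+1)
  (gb : Mb -> 'rV[R]_n.+2 -> 'rV[R]_n.+2 -> R)
  (nablab nablabs :
    (Mb -> 'rV[R]_n.+2) -> (Mb -> 'rV[R]_n.+2) -> Mb -> 'rV[R]_n.+2)
  (F : M -> Mb)
  (SM : M -> set 'rV[R]_n.+1)
  (D Ds : (M -> 'rV[R]_n.+1) -> (M -> 'rV[R]_n.+2) -> M -> 'rV[R]_n.+2)
  (nabla nablas nablaS nablasS :
    (M -> 'rV[R]_n.+1) -> (M -> 'rV[R]_n.+1) -> M -> 'rV[R]_n.+1)
  (hstat : statistical_manifold gb nablab nablabs)
  (hlight : lightlike_hypersurface gb F)
  (hscreen : screen_distribution gb F SM)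
  (hD : pullback_connection F nablab D)
  (hDs : pullback_connection F nablabs Ds)
  (hnabla : induced_connection gb F SM D nabla)
  (hnablas : induced_connection gb F SM Ds nablas)
  (hnablaS : screen_connection gb F SM nabla nablaS)
  (hnablasS : screen_connection gb F SM nablas nablasS)
  (hrad : parallel (radical gb F) nabla)
  (hrads : parallel (radical gb F) nablas)
  (hS : parallel SM nabla)
  (hSs : parallel SM nablas) :
  [<-> metric_connection (induced_metric gb F) nabla;
       metric_connection (induced_metric gb F) nablas;
       forall X W, vfield X -> section_of SM W ->
         forall p, difference_tensor nabla nablas X W p = 0;
       forall X W, vfield X -> section_of SM W ->
         forall p, nablaS X W p = nablasS X W p].
Proof.
have [hg _ _ _ _ hdual] := hstat; have sF := hlight.1.1.
have cD := hD.1; have cDs := hDs.1.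
have dualD X V W p : vfield X -> smooth_section F V -> smooth_section F W ->
    dual_defect F gb D Ds X V W p = 0.
  by move=> sX; apply: (pullback_duality F gb sF hg nablab nablabs).
(* Duality is symmetric, so the lemmas on the dual pair also apply with the two connections
   exchanged. *)
have dualDs X V W p : vfield X -> smooth_section F V -> smooth_section F W ->
    dual_defect F gb Ds D X V W p = 0.
  by move=> sX sV sW; rewrite dual_defect_sym// dualD.
have eqS X W p : vfield X -> section_of SM W -> nabla X W p = nablaS X W p.
  exact: (screen_connection_parallel gb F SM hg hlight hscreen).
have eqSs X W p : vfield X -> section_of SM W -> nablas X W p = nablasS X W p.
  exact: (screen_connection_parallel gb F SM hg hlight hscreen).
tfae.
(* The passage from [nabla] to [nablas] goes through their agreement on the screen, which is
   symmetric in the two. *)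
- move=> hm; apply: (screen_eq_metric gb F SM hg hlight hscreen Ds D nablas nabla) => //.
  by move=> X W sX SW p; apply/esym;
    apply: (metric_screen_eq gb F SM hg hlight hscreen D Ds nabla nablas).
- move=> hm X W sX SW p; rewrite /difference_tensor.
  rewrite (metric_screen_eq gb F SM hg hlight hscreen Ds D nablas nabla)//.
  by rewrite subrr scaler0.
- move=> hK X W sX SW p; rewrite -eqS// -eqSs//.
  have /eqP := hK X W sX SW p.
  by rewrite scaler_eq0 invr_eq0 pnatr_eq0/= subr_eq0 => /eqP.
- move=> hSS; apply: (screen_eq_metric gb F SM hg hlight hscreen D Ds nabla nablas) => //.
  by move=> X W sX SW p; rewrite eqS// hSS// -eqSs.
Qed.
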